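(* Let $k$ be a commutative ring, let $A\,|\,B$ be an algebra extension of $k$-algebras (an identity-preserving algebra homomorphism $B\to A$), let $R=C_A(B)$ be the centralizer of (the image of) $B$ in $A$, and let $T=(A\otimes_BA)^B=\{t\in A\otimes_BA: bt=tb\ \text{for all } b\in B\}$. If $A\,|\,B$ is right depth two or left depth two, then $T$, with the structure described in the context, is a right bialgebroid over $R$.
   Context: Algebras are unital and associative over $k$. Elements of $A\otimes_BA$ are written $t=t^1\otimes_Bt^2$ (summation suppressed). $A\,|\,B$ is right (resp. left) depth two (D2) if for some (possibly infinite) set $I$, $A\otimes_BA$ is isomorphic, as a natural $A$-$B$-bimodule (resp. $B$-$A$-bimodule), to a direct summand of the direct sum $A^{(I)}$. Right D2 is equivalent to the existence of right D2 quasibases: $u_i\in T$, $\gamma_i\in\mathrm{End}({}_BA_B)$ ($i\in I$) such that for each $a\in A$, $\gamma_i(a)=0$ for all but finitely many $i$, and $x\otimes_By=\sum_i x\gamma_i(y)u_i$ for all $x,y\in A$. Left D2 is equivalent to the existence of left D2 quasibases: $t_i\in T$, $\beta_i\in\mathrm{End}({}_BA_B)$ ($i\in I$) with, for each $a\in A$, $\beta_i(a)=0$ for all but finitely many $i$, and $x\otimes_By=\sum_i t_i\beta_i(x)y$ for all $x,y\in A$. Structure on $T$: multiplication $tu=u^1t^1\otimes_Bt^2u^2$, unit $1_T=1_A\otimes_B1_A$; $s_R:R\to T$, $s_R(r)=1_A\otimes_Br$; $t_R:R\to T$, $t_R(r)=r\otimes_B1_A$; hence the $R$-$R$-bimodule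 structure $r\cdot t\cdot s=t\,t_R(r)s_R(s)=rt^1\otimes_Bt^2s$; counit $\varepsilon(t)=t^1t^2$; comultiplication $\Delta(t)=\sum_{i}(t^1\otimes_B\gamma_i(t^2))\otimes_Ru_i$ in the right D2 case, and $\Delta(t)=\sum_i t_i\otimes_R(\beta_i(t^1)\otimes_Bt^2)$ in the left D2 case. Right $R$-bialgebroid: a $k$-algebra $T$ with an algebra homomorphism $s_R:R\to T$ and an algebra anti-homomorphism $t_R:R\to T$ with commuting images; $T$ is an $R$-$R$-bimodule by $r\cdot t\cdot s=t\,t_R(r)s_R(s)$; and there are $R$-$R$-bimodule maps $\Delta:T\to T\otimes_RT$, $\Delta(t)=t_{(1)}\otimes_Rt_{(2)}$, and $\varepsilon:T\to R$ making $T$ a coassociative counital $R$-coring, such that $\Delta(1)=1\otimes_R1$, $\varepsilon(1_T)=1_R$, $s_R(r)t_{(1)}\otimes_Rt_{(2)}=t_{(1)}\otimes_Rt_R(r)t_{(2)}$, $\Delta(tu)=t_{(1)}u_{(1)}\otimes_Rt_{(2)}u_{(2)}$, and $\varepsilon(tu)=\varepsilon(s_R(\varepsilon(t))u)=\varepsilon(t_R(\varepsilon(t))u)$ for all $r\in R$, $t,u\in T$. *)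

(* Defs.v *)
From HB Require Import structures.
From mathcomp Require Import all_boot all_algebra finmap generic_quotient
  ring_quotient.
From mathcomp Require Import boolp classical_sets functions cardinality fsbigop.
From mathcomp.multinomials Require Import monalg.

Set Implicit Arguments.
Unset Strict Implicit.
Unset Printing Implicit Defensive.

Import GRing.Theory.
Local Open Scope ring_scope.

Reserved Notation "a <* m" (at level 40, left associativity).
Reserved Notation "m *> a" (at level 40, left associativity).
Reserved Notation "m \ox n" (at level 40, left associativity).

(* A unital associative algebra over a commutative ring k is a ring with a ring
   morphism from k to its center.  Unlike [algType k], this includes the zero
   algebra. *)
HB.mixin Record isPzAlgebra (k : comPzRingType) A of GRing.PzRing A := {
  scal : {rmorphism k -> A};
  scalC : forall (a : k) (x : A), scal a * x = x * scal a
}.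

#[short(type="pzAlgType")]
HB.structure Definition PzAlgebra (k : comPzRingType) :=
  {A of isPzAlgebra k A & GRing.PzRing A}.

Record algHom (k : comPzRingType) (A B : pzAlgType k) := AlgHom {
  alg_hom_fun :> {rmorphism A -> B};
  alg_hom_scal : forall a : k, alg_hom_fun (scal a) = scal a
}.

(* Preservation of 1 is the case a = 1 of the last clause. *)
Definition alg_antihom (k : comPzRingType) (A B : pzAlgType k) (f : A -> B) :=
  [/\ {morph f : x y / x + y}, {morph f : x y / x * y >-> y * x}
    & forall a : k, f (scal a) = scal a].

#[local] Obligation Tactic := idtac.

Record bimod (P Q : pzRingType) := Bimod {
  bimod_sort :> zmodType;
  lact : P -> bimod_sort -> bimod_sort;
  ract : bimod_sort -> Q -> bimod_sort;
  lactDl : forall a b m, lact (a + b) m = lact a m + lact b m;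
  lactDr : forall a m n, lact a (m + n) = lact a m + lact a n;
  lactA : forall a b m, lact a (lact b m) = lact (a * b) m;
  lact1 : forall m, lact 1 m = m;
  ractDl : forall m n a, ract (m + n) a = ract m a + ract n a;
  ractDr : forall m a b, ract m (a + b) = ract m a + ract m b;
  ractA : forall m a b, ract (ract m a) b = ract m (a * b);
  ract1 : forall m, ract m 1 = m;
  lractA : forall a m b, lact a (ract m b) = ract (lact a m) b
}.

Notation "a <* m" := (lact a m) : ring_scope.
Notation "m *> a" := (ract m a) : ring_scope.

Section BimodMorphisms.
Context (P Q : pzRingType).
Implicit Types M N C : bimod P Q.

Definition bimod_hom M N (f : M -> N) : Prop :=
  [/\ {morph f : m n / m + n}, forall a m, f (a <* m) = a <* f m
    & forall m a, f (m *> a) = f m *> a].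

Record bimodHom M N := BimodHom {
  bimod_hom_fun :> M -> N;
  bimod_homP : bimod_hom bimod_hom_fun
}.

Definition bimod_iso M N :=
  exists f : M -> N, bimod_hom f /\ bijective f.

Program Definition prodB M N : bimod P Q :=
  @Bimod P Q (M * N)%type
    (fun a x => (a <* x.1, a <* x.2)) (fun x a => (x.1 *> a, x.2 *> a))
    _ _ _ _ _ _ _ _ _.
Next Obligation. by move=> M N a b m; rewrite /= !lactDl. Qed.
Next Obligation. by move=> M N a m n; rewrite /= !lactDr. Qed.
Next Obligation. by move=> M N a b m; rewrite /= !lactA. Qed.
Next Obligation. by move=> M N [m n]; rewrite /= !lact1. Qed.
Next Obligation. by move=> M N m n a; rewrite /= !ractDl. Qed.
Next Obligation. by move=> M N m a b; rewrite /= !ractDr. Qed.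
Next Obligation. by move=> M N m a b; rewrite /= !ractA. Qed.
Next Obligation. by move=> M N [m n]; rewrite /= !ract1. Qed.
Next Obligation. by move=> M N a m b; rewrite /= !lractA. Qed.

Definition direct_summand M N := exists C, bimod_iso (prodB M C) N.

Lemma lact0 M a : a <* (0 : M) = 0.
Proof. by apply: (addrI (a <* 0)); rewrite -lactDr !addr0. Qed.

Lemma ract0 M a : (0 : M) *> a = 0.
Proof. by apply: (addrI (0 *> a)); rewrite -ractDl !addr0. Qed.

Lemma lact0l M (m : M) : 0 <* m = 0.
Proof. by apply: (addrI (0 <* m)); rewrite -lactDl !addr0. Qed.

Lemma ract0r M (m : M) : m *> 0 = 0.
Proof. by apply: (addrI (m *> 0)); rewrite -ractDr !addr0. Qed.

(* The direct sum M^(I): the finitely supported families I -> M. *)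
Section DirectSum.
Context (I : choiceType) (M : bimod P Q).

Definition dsum_lact a (g : {malg M[I]}) : {malg M[I]} :=
  [malg i in msupp g => a <* g@_i].
Definition dsum_ract (g : {malg M[I]}) a : {malg M[I]} :=
  [malg i in msupp g => g@_i *> a].

Lemma dsum_lactE a g i : (dsum_lact a g)@_i = a <* g@_i.
Proof. by rewrite mcoeffE; case: msuppP; rewrite // lact0. Qed.

Lemma dsum_ractE g a i : (dsum_ract g a)@_i = g@_i *> a.
Proof. by rewrite mcoeffE; case: msuppP; rewrite // ract0. Qed.

Program Definition dsumB : bimod P Q :=
  @Bimod P Q {malg M[I]} dsum_lact dsum_ract _ _ _ _ _ _ _ _ _.
Next Obligation.
by move=> /= a b m; apply/malgP => i; rewrite mcoeffD !dsum_lactE lactDl.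
Qed.
Next Obligation.
by move=> /= a m n; apply/malgP => i; rewrite !(mcoeffD, dsum_lactE) lactDr.
Qed.
Next Obligation.
by move=> /= a b m; apply/malgP => i; rewrite !dsum_lactE lactA.
Qed.
Next Obligation. by move=> /= m; apply/malgP => i; rewrite dsum_lactE lact1. Qed.
Next Obligation.
by move=> /= m n a; apply/malgP => i; rewrite !(mcoeffD, dsum_ractE) ractDl.
Qed.
Next Obligation.
by move=> /= m a b; apply/malgP => i; rewrite mcoeffD !dsum_ractE ractDr.
Qed.
Next Obligation.
by move=> /= m a b; apply/malgP => i; rewrite !dsum_ractE ractA.
Qed.
Next Obligation. by move=> /= m; apply/malgP => i; rewrite dsum_ractE ract1. Qed.
Next Obligation.
by move=> /= a m b; apply/malgP => i; rewrite !(dsum_lactE, dsum_ractE) lractA.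
Qed.

End DirectSum.
End BimodMorphisms.

Program Definition regB (A : pzRingType) : bimod A A :=
  @Bimod A A A (fun a m => a * m) (fun m a => m * a) _ _ _ _ _ _ _ _ _.
Next Obligation. by move=> A a b m; rewrite /= mulrDl. Qed.
Next Obligation. by move=> A a b m; rewrite /= mulrDr. Qed.
Next Obligation. by move=> A a b m; rewrite /= mulrA. Qed.
Next Obligation. by move=> A a; rewrite /= mul1r. Qed.
Next Obligation. by move=> A a b m; rewrite /= mulrDl. Qed.
Next Obligation. by move=> A a b m; rewrite /= mulrDr. Qed.
Next Obligation. by move=> A a b m; rewrite /= mulrA. Qed.
Next Obligation. by move=> A a; rewrite /= mulr1. Qed.
Next Obligation. by move=> A a b m; rewrite /= mulrA. Qed.

(* Restriction of scalars. *)
Program Definition resB (P Q P' Q' : pzRingType) (f : {rmorphism P' -> P})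
    (g : {rmorphism Q' -> Q}) (M : bimod P Q) : bimod P' Q' :=
  @Bimod P' Q' M (fun a m => f a <* m) (fun m a => m *> g a)
    _ _ _ _ _ _ _ _ _.
Next Obligation. by move=> *; rewrite /= rmorphD lactDl. Qed.
Next Obligation. by move=> *; rewrite /= lactDr. Qed.
Next Obligation. by move=> *; rewrite /= lactA rmorphM. Qed.
Next Obligation. by move=> *; rewrite /= rmorph1 lact1. Qed.
Next Obligation. by move=> *; rewrite /= ractDl. Qed.
Next Obligation. by move=> *; rewrite /= rmorphD ractDr. Qed.
Next Obligation. by move=> *; rewrite /= ractA rmorphM. Qed.
Next Obligation. by move=> *; rewrite /= rmorph1 ract1. Qed.
Next Obligation. by move=> *; rewrite /= lractA. Qed.

Fact tens_key : unit. Proof. exact: tt. Qed.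

(* The tensor product of M and N over Q is the free abelian group on M * N
   modulo the subgroup generated by the usual relators. *)
Section Tensor.
Context (P Q S : pzRingType) (M : bimod P Q) (N : bimod Q S).
Local Notation F := {malg int[(M * N)%type]}.
Local Notation "<[ m , n ]>" := (<< ((m, n) : (M * N)%type) >> : F).

Inductive tens_null : F -> Prop :=
| TensNullDl m m' n : tens_null (<[m + m', n]> - (<[m, n]> + <[m', n]>))
| TensNullDr m n n' : tens_null (<[m, n + n']> - (<[m, n]> + <[m, n']>))
| TensNullA m a n : tens_null (<[m *> a, n]> - <[m, a <* n]>)
| TensNull0 : tens_null 0
| TensNullB x y : tens_null x -> tens_null y -> tens_null (x - y).

Definition tens_null_pred : {pred F} := fun z => `[< tens_null z >].

Lemma tens_null_closed : zmod_closed tens_null_pred.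
Proof.
split; first by apply/asboolP; exact: TensNull0.
by move=> x y /asboolP hx /asboolP hy; apply/asboolP; exact: TensNullB.
Qed.

HB.instance Definition _ :=
  GRing.isZmodClosed.Build F tens_null_pred tens_null_closed.

Definition tens : Type := {ideal_quot tens_null_pred}.

HB.instance Definition _ := GRing.Zmodule.on tens.

Definition pure : M -> N -> tens := locked_with tens_key
  (fun m n => \pi_({ideal_quot tens_null_pred})%qT <[m, n]>).
Local Notation "m \ox n" := (pure m n).

Section Lift.
Context (V : zmodType).
Implicit Types f : M -> N -> V.

Definition balanced f :=
  [/\ forall m m' n, f (m + m') n = f m n + f m' n,
      forall m n n', f m (n + n') = f m n + f m n'
    & forall m a n, f (m *> a) n = f m (a <* n)].

Definition free_lift f (z : F) : V :=
  \sum_(p <- msupp z) f p.1 p.2 *~ z@_p.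

(* The map induced by f; it is computed on a chosen representative, hence
   meaningful for balanced f only, where tens_liftE and tens_liftD hold.
   Thus tens_lift f x is "f x^1 x^2", summation understood. *)
Definition tens_lift : (M -> N -> V) -> tens -> V := locked_with tens_key
  (fun f x => free_lift f (repr (x : {ideal_quot tens_null_pred}))).

Lemma free_liftEw f z (d : {fset (M * N)%type}) : (msupp z `<=` d)%fset ->
  free_lift f z = \sum_(p <- d) f p.1 p.2 *~ z@_p.
Proof.
move=> le_d; rewrite /free_lift (big_fset_incl _ le_d) // => p _ pz.
by rewrite mcoeff_outdom // mulr0z.
Qed.

Lemma free_liftB f : {morph free_lift f : x y / x - y}.
Proof.
move=> x y; rewrite (free_liftEw f (msuppB_le x y)).
rewrite (free_liftEw f (fsubsetUl (msupp x) (msupp y))).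
rewrite (free_liftEw f (fsubsetUr (msupp x) (msupp y))) -sumrB.
by apply: eq_bigr => p _; rewrite mcoeffB mulrzBr.
Qed.

Lemma free_lift0 f : free_lift f 0 = 0.
Proof. by rewrite -[X in free_lift _ X](subrr 0) free_liftB subrr. Qed.

Lemma free_liftD f : {morph free_lift f : x y / x + y}.
Proof.
by move=> x y; rewrite -{1}[y]opprK -[- y]sub0r !free_liftB free_lift0 sub0r opprK.
Qed.

Lemma free_liftU f m n : free_lift f <[m, n]> = f m n.
Proof.
rewrite (free_liftEw f (@msuppU_le _ _ _ _)) big_seq_fset1 /=.
by rewrite mcoeffUU mulr1z.
Qed.

Lemma tens_null_lift f z : balanced f -> tens_null z -> free_lift f z = 0.
Proof.
case=> fDl fDr fA; elim=> {z}.
- by move=> m m' n; rewrite free_liftB free_liftD !free_liftU fDl subrr.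
- by move=> m n n'; rewrite free_liftB free_liftD !free_liftU fDr subrr.
- by move=> m a n; rewrite free_liftB !free_liftU fA subrr.
- exact: free_lift0.
- by move=> x y _ IHx _ IHy; rewrite free_liftB IHx IHy subrr.
Qed.

Lemma tens_lift_pi f z : balanced f ->
  tens_lift f (\pi_({ideal_quot tens_null_pred})%qT z) = free_lift f z.
Proof.
move=> balf; apply/eqP; rewrite /tens_lift locked_withE -subr_eq0 -free_liftB; apply/eqP.
apply: tens_null_lift => //; apply/asboolP.
suff : repr (\pi_({ideal_quot tens_null_pred})%qT z) - z \in tens_null_pred by [].
by rewrite Quotient.idealrBE reprK.
Qed.

Lemma tens_liftE f m n : balanced f -> tens_lift f (m \ox n) = f m n.
Proof. by move=> balf; rewrite /pure locked_withE tens_lift_pi // free_liftU. Qed.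

Lemma tens_liftD f : balanced f -> {morph tens_lift f : x y / x + y}.
Proof.
move=> balf x y; rewrite -[x]reprK -[y]reprK.
set X := repr x; set Y := repr y.
suff -> : \pi_({ideal_quot tens_null_pred})%qT X
   + \pi_({ideal_quot tens_null_pred})%qT Y =
   \pi_({ideal_quot tens_null_pred})%qT (X + Y) :> {ideal_quot tens_null_pred}.
  by rewrite !tens_lift_pi // free_liftD.
by rewrite raddfD.
Qed.

End Lift.
Lemma tens_piP (x y : F) : tens_null (x - y) ->
  \pi_({ideal_quot tens_null_pred})%qT x = \pi_({ideal_quot tens_null_pred})%qT y.
Proof. by move=> hxy; apply/eqP; rewrite -Quotient.idealrBE; apply/asboolP. Qed.

Lemma tens_piD (x y : F) : \pi_({ideal_quot tens_null_pred})%qT (x + y) =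
  \pi_({ideal_quot tens_null_pred})%qT x + \pi_({ideal_quot tens_null_pred})%qT y.
Proof. by rewrite raddfD. Qed.

Lemma pureDl m m' n : (m + m') \ox n = m \ox n + m' \ox n.
Proof. by rewrite /pure locked_withE (tens_piP (TensNullDl m m' n)) tens_piD. Qed.

Lemma pureDr m n n' : m \ox (n + n') = m \ox n + m \ox n'.
Proof. by rewrite /pure locked_withE (tens_piP (TensNullDr m n n')) tens_piD. Qed.

Lemma pureA m a n : (m *> a) \ox n = m \ox (a <* n).
Proof. by rewrite /pure locked_withE; exact: tens_piP (TensNullA m a n). Qed.

Lemma pure0l n : 0 \ox n = 0.
Proof. by apply: (addrI (0 \ox n)); rewrite -pureDl !addr0. Qed.

Lemma pure0r m : m \ox 0 = 0.
Proof. by apply: (addrI (m \ox 0)); rewrite -pureDr !addr0. Qed.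

Lemma pureNl m n : (- m) \ox n = - (m \ox n).
Proof. by apply: (addrI (m \ox n)); rewrite -pureDl !subrr pure0l. Qed.

Lemma tens_ind (Pr : tens -> Prop) :
  (forall m n, Pr (m \ox n)) -> (forall x y, Pr x -> Pr y -> Pr (x + y)) ->
  forall x, Pr x.
Proof.
move=> Pp PD x; rewrite -[x]reprK; set z := repr x.
have P0 : Pr 0 by rewrite -(pure0l 0).
rewrite [z]monalgE raddf_sum /=; apply: (big_ind Pr) => // p _.
have -> : << z@_p *g p >> = << p >> *~ z@_p :> F.
  apply/malgP => q; rewrite -[RHS]/(mcoeff q _) raddfMz /= !mcoeffU.
  by case: (p == q); rewrite ?mulr1n ?mulr0n ?mul0rz ?intz.
have -> : \pi_({ideal_quot tens_null_pred})%qT (<< p >> *~ z@_p : F) =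
    \pi_({ideal_quot tens_null_pred})%qT (<< p >> : F) *~ z@_p by exact: raddfMz.
case: p => m n.
have -> : \pi_({ideal_quot tens_null_pred})%qT <[m, n]> = m \ox n.
  by rewrite /pure locked_withE.
have Pn i : Pr ((m \ox n) *+ i).
  by elim: i => [|i IH]; rewrite ?mulr0n ?mulrS //; apply: PD.
have PN i : Pr ((m \ox n) *- i).
  by rewrite -mulNrn -pureNl; elim: i => [|i IH]; rewrite ?mulr0n ?mulrS //; apply: PD.
by case: (z@_(m, n)) => i; [exact: Pn i | exact: PN i.+1].
Qed.

Lemma eq_tens (V : zmodType) (f g : tens -> V) :
  {morph f : x y / x + y} -> {morph g : x y / x + y} ->
  (forall m n, f (m \ox n) = g (m \ox n)) -> f =1 g.
Proof.
by move=> fD gD fg; apply: tens_ind => // x y fx fy; rewrite fD gD fx fy.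
Qed.

Definition tens_lact a : tens -> tens := tens_lift (fun m n => (a <* m) \ox n).
Definition tens_ract (x : tens) a : tens :=
  tens_lift (fun m n => m \ox (n *> a)) x.

Lemma tens_lact_bal a : balanced (fun m n => (a <* m) \ox n).
Proof.
split=> [m m' n|m n n'|m b n]; first by rewrite lactDr pureDl.
  by rewrite pureDr.
by rewrite lractA pureA.
Qed.

Lemma tens_ract_bal a : balanced (fun m n => m \ox (n *> a)).
Proof.
split=> [m m' n|m n n'|m b n]; first by rewrite pureDl.
  by rewrite ractDl pureDr.
by rewrite -lractA pureA.
Qed.

Lemma tens_lactE a m n : tens_lact a (m \ox n) = (a <* m) \ox n.
Proof. by apply: tens_liftE; exact: tens_lact_bal. Qed.
Lemma tens_ractE m n a : tens_ract (m \ox n) a = m \ox (n *> a).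
Proof. by apply: tens_liftE; exact: tens_ract_bal. Qed.
Lemma tens_lactD a : {morph tens_lact a : x y / x + y}.
Proof. by apply: tens_liftD; exact: tens_lact_bal. Qed.
Lemma tens_ractD a : {morph tens_ract^~ a : x y / x + y}.
Proof. by apply: tens_liftD; exact: tens_ract_bal. Qed.

Program Definition tensB : bimod P S :=
  @Bimod P S tens tens_lact tens_ract _ _ _ _ _ _ _ _ _.
Next Obligation.
move=> a b; elim/tens_ind => [m n|x y IHx IHy].
  by rewrite !tens_lactE lactDl pureDl.
by rewrite !tens_lactD IHx IHy addrACA.
Qed.
Next Obligation. by move=> a m n; rewrite tens_lactD. Qed.
Next Obligation.
move=> a b; elim/tens_ind => [m n|x y IHx IHy].
  by rewrite !tens_lactE lactA.
by rewrite !tens_lactD IHx IHy.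
Qed.
Next Obligation.
elim/tens_ind => [m n|x y IHx IHy]; first by rewrite tens_lactE lact1.
by rewrite tens_lactD IHx IHy.
Qed.
Next Obligation. by move=> a m n; rewrite tens_ractD. Qed.
Next Obligation.
move=> x a b; elim/tens_ind: x => [m n|x y IHx IHy].
  by rewrite !tens_ractE ractDr pureDr.
by rewrite !tens_ractD IHx IHy addrACA.
Qed.
Next Obligation.
move=> x a b; elim/tens_ind: x => [m n|x y IHx IHy].
  by rewrite !tens_ractE ractA.
by rewrite !tens_ractD IHx IHy.
Qed.
Next Obligation.
elim/tens_ind => [m n|x y IHx IHy]; first by rewrite tens_ractE ract1.
by rewrite tens_ractD IHx IHy.
Qed.
Next Obligation.
move=> a x b; elim/tens_ind: x => [m n|x y IHx IHy].
  by rewrite !(tens_lactE, tens_ractE).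
by rewrite !(tens_lactD, tens_ractD) IHx IHy.
Qed.

Lemma lact_pure a m n : a <* (m \ox n : tensB) = (a <* m) \ox n.
Proof. exact: tens_lactE. Qed.

Lemma ract_pure m n a : (m \ox n : tensB) *> a = m \ox (n *> a).
Proof. exact: tens_ractE. Qed.

End Tensor.

Arguments tensB {P Q S} M N : simpl never.
Arguments tens_lift : simpl never.
Arguments lact : simpl never.
Arguments ract : simpl never.

Notation "m \ox n" := (pure m n) : ring_scope.

Section TensorMaps.
Context (P Q S P' Q' S' : pzRingType).
Context (M : bimod P Q) (N : bimod Q S) (M' : bimod P' Q') (N' : bimod Q' S').

Definition tens_map (g : M -> M') (h : N -> N') : tens M N -> tens M' N' :=
  tens_lift (fun m n => g m \ox h n).

End TensorMaps.

Definition tens_assoc (P Q S U : pzRingType) (L : bimod P Q) (M : bimod Q S)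
    (N : bimod S U) : tens (tensB L M) N -> tens L (tensB M N) :=
  tens_lift (fun (x : tensB L M) n =>
    tens_lift (fun l m => l \ox ((m \ox n) : tensB M N)) x).

Section Bialgebroid.
Context (k : comPzRingType) (R T : pzAlgType k).

Record bialg_base := BialgBase {
  src : algHom R T;
  tgt : R -> T;
  tgt_antihom : alg_antihom tgt;
  src_tgtC : forall r s, src r * tgt s = tgt s * src r
}.

Program Definition baseB (S : bialg_base) : bimod R R :=
  @Bimod R R T (fun r t => t * tgt S r) (fun t r => t * src S r)
    _ _ _ _ _ _ _ _ _.
Next Obligation.
by move=> S r s t; case: (tgt_antihom S) => tD _ _; rewrite /= tD mulrDr.
Qed.
Next Obligation. by move=> S r t u; rewrite /= mulrDl. Qed.
Next Obligation.
by move=> S r s t; case: (tgt_antihom S) => _ tM _; rewrite /= tM mulrA.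
Qed.
Next Obligation.
move=> S t; case: (tgt_antihom S) => _ _ tk /=.
by rewrite -(rmorph1 (@scal k R)) tk rmorph1 mulr1.
Qed.
Next Obligation. by move=> S t u r; rewrite /= mulrDl. Qed.
Next Obligation. by move=> S t r s; rewrite /= rmorphD mulrDr. Qed.
Next Obligation. by move=> S t r s; rewrite /= rmorphM mulrA. Qed.
Next Obligation. by move=> S t; rewrite /= rmorph1 mulr1. Qed.
Next Obligation. by move=> S r t s; rewrite /= -!mulrA src_tgtC. Qed.

(* [sweedler (fun t1 t2 => E) (Delta t)] is the expression E, summation
   understood, for t1 = t_(1) and t2 = t_(2).  Each such E is balanced as a
   consequence of the preceding fields; in DeltaM the outer one is so because
   of Delta_takeuchi for u. *)
Section BialgebroidLaws.
Context (S : bialg_base).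
Local Notation TB := (baseB S).
Local Notation TT := (tensB TB TB).
Local Notation "t \oxR u" := (@pure R R R TB TB t u)
  (at level 40, left associativity).
Local Notation sweedler E x := (@tens_lift R R R TB TB _ E x).

Record is_right_bialgebroid (Delta : T -> tens TB TB) (eps : T -> R) : Prop := {
  Delta_bimod : @bimod_hom R R TB TT Delta;
  eps_bimod : @bimod_hom R R TB (regB R) eps;
  Delta_coassoc : forall t,
    tens_assoc (@tens_map R R R R R R TB TB TT TB Delta id (Delta t)) =
    @tens_map R R R R R R TB TB TB TT id Delta (Delta t);
  eps_counitl : forall t, sweedler (fun t1 t2 : TB => eps t1 <* t2) (Delta t) = t;
  eps_counitr : forall t, sweedler (fun t1 t2 : TB => t1 *> eps t2) (Delta t) = t;
  Delta1 : Delta 1 = 1 \oxR 1;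
  eps1 : eps 1 = 1;
  Delta_takeuchi : forall r t,
    sweedler (fun t1 t2 => (src S r * t1) \oxR t2) (Delta t) =
    sweedler (fun t1 t2 => t1 \oxR (tgt S r * t2)) (Delta t);
  DeltaM : forall t u, Delta (t * u) =
    sweedler (fun t1 t2 =>
      sweedler (fun u1 u2 => (t1 * u1) \oxR (t2 * u2)) (Delta u)) (Delta t);
  eps_src : forall t u, eps (t * u) = eps (src S (eps t) * u);
  eps_tgt : forall t u, eps (t * u) = eps (tgt S (eps t) * u)
}.

End BialgebroidLaws.
End Bialgebroid.

Lemma direct_summandP (P Q : pzRingType) (M N : bimod P Q) :
  direct_summand M N -> exists (p : M -> N) (q : N -> M),
    [/\ bimod_hom p, bimod_hom q & cancel p q].
Proof.
case=> C [h [[hD hl hr] [h' hK h'K]]].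
exists (fun m => h ((m, 0) : prodB M C)), (fun n => (h' n).1); split.
- split=> [m n|a m|m a].
  + rewrite -hD; congr h; rewrite -[RHS]/(m + n, 0 + 0); by rewrite addr0.
  + rewrite -hl; congr h; rewrite -[RHS]/(a <* m, a <* 0); by rewrite lact0.
  + rewrite -hr; congr h; rewrite -[RHS]/(m *> a, 0 *> a); by rewrite ract0.
- split=> [m n|a m|m a].
  + have -> : h' (m + n) = h' m + h' n by rewrite -{1}[m]h'K -{1}[n]h'K -hD hK.
    by [].
  + have -> : h' (a <* m) = a <* h' m by rewrite -{1}[m]h'K -hl hK.
    by [].
  + have -> : h' (m *> a) = h' m *> a by rewrite -{1}[m]h'K -hr hK.
    by [].
- by move=> m; rewrite hK.
Qed.

Section Extension.
Context (k : comPzRingType) (B A : pzAlgType k) (f : algHom B A).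

Definition ABB : bimod A B := resB idfun f (regB A).
Definition BBA : bimod B A := resB f idfun (regB A).
Definition BAB : bimod B B := resB f f (regB A).
Definition AoA : bimod A A := tensB ABB BBA.

(* Index sets are choice types; classically every type is one. *)
Definition right_D2 : Prop := exists I : choiceType,
  direct_summand (resB idfun f AoA) (dsumB I ABB).

Definition left_D2 : Prop := exists I : choiceType,
  direct_summand (resB f idfun AoA) (dsumB I BBA).

Definition cent_pred : {pred A} := fun a => `[< forall b, f b * a = a * f b >].

Lemma cent_predP a : reflect (forall b, f b * a = a * f b) (a \in cent_pred).
Proof. exact: asboolP. Qed.

Lemma cent_closed : subring_closed cent_pred.
Proof.
split=> [|x y /cent_predP hx /cent_predP hy|x y /cent_predP hx /cent_predP hy];
  apply/cent_predP => b.
- by rewrite mulr1 mul1r.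
- by rewrite mulrBr mulrBl hx hy.
- by rewrite mulrA hx -mulrA hy mulrA.
Qed.

HB.instance Definition _ :=
  GRing.isSubringClosed.Build A cent_pred cent_closed.

Record centralizer := Centralizer {
  cent_val :> A;
  cent_valP : cent_val \in cent_pred
}.

HB.instance Definition _ := [isSub for cent_val].
HB.instance Definition _ := [Choice of centralizer by <:].
HB.instance Definition _ :=
  GRing.SubChoice_isSubPzRing.Build A cent_pred centralizer cent_closed.

Lemma centE (r : centralizer) b : f b * cent_val r = cent_val r * f b.
Proof. exact/cent_predP/cent_valP. Qed.

Lemma scal_cent a : (scal a : A) \in cent_pred.
Proof. by apply/cent_predP => b; rewrite scalC. Qed.

Definition cent_scal a : centralizer := Centralizer (scal_cent a).

Lemma cent_scal_zmod : zmod_morphism cent_scal.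
Proof. by move=> a b; apply: val_inj; rewrite /= rmorphB. Qed.

Lemma cent_scal_monoid : monoid_morphism cent_scal.
Proof.
by split=> [|a b]; apply: val_inj; rewrite /= ?rmorph1 ?rmorphM.
Qed.

HB.instance Definition _ :=
  GRing.isZmodMorphism.Build k centralizer cent_scal cent_scal_zmod.
HB.instance Definition _ :=
  GRing.isMonoidMorphism.Build k centralizer cent_scal cent_scal_monoid.

Lemma cent_scalC a (r : centralizer) : cent_scal a * r = r * cent_scal a.
Proof. by apply: val_inj; rewrite /= scalC. Qed.

HB.instance Definition _ := isPzAlgebra.Build k centralizer cent_scalC.

Local Notation "x \oxB y" := (@pure A B A ABB BBA x y)
  (at level 40, left associativity).

Lemma oxA x b y : (x * f b) \oxB y = x \oxB (f b * y).
Proof. exact: (@pureA A B A ABB BBA). Qed.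

Lemma oxl a x y : a <* (x \oxB y : AoA) = (a * x) \oxB y.
Proof. exact: (@lact_pure A B A ABB BBA). Qed.

Lemma oxr x y a : (x \oxB y : AoA) *> a = x \oxB (y * a).
Proof. exact: (@ract_pure A B A ABB BBA). Qed.

(* (A \ox_B A)^B *)
Definition inv_pred : {pred AoA} :=
  fun t => `[< forall b, f b <* t = t *> f b >].

Lemma inv_predP (t : AoA) :
  reflect (forall b, f b <* t = t *> f b) (t \in inv_pred).
Proof. exact: asboolP. Qed.

Lemma inv_closed : zmod_closed inv_pred.
Proof.
split=> [|x y /inv_predP hx /inv_predP hy]; apply/inv_predP => b.
  by rewrite lact0 ract0.
have hN : (f b <* (- y) = (- y) *> f b).
  by apply: (addrI (f b <* y)); rewrite -lactDr [in RHS]hy -ractDl !subrr lact0 ract0.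
by rewrite lactDr ractDl hx hN.
Qed.

HB.instance Definition _ := GRing.isZmodClosed.Build AoA inv_pred inv_closed.

Record tens_inv := TensInv {
  inv_val :> AoA;
  inv_valP : inv_val \in inv_pred
}.

HB.instance Definition _ := [isSub for inv_val].
HB.instance Definition _ := [Choice of tens_inv by <:].
HB.instance Definition _ := [SubChoice_isSubZmodule of tens_inv by <:].

Lemma invE (t : tens_inv) b : f b <* inv_val t = inv_val t *> f b.
Proof. exact/inv_predP/inv_valP. Qed.

(* u^1 t^1 \ox t^2 u^2 *)
Definition inv_mul (t : tens_inv) : AoA -> AoA :=
  @tens_lift A B A ABB BBA AoA (fun u1 u2 : A => (u1 <* inv_val t) *> u2).

Lemma inv_mul_bal (t : tens_inv) :
  @balanced A B A ABB BBA AoA (fun u1 u2 : A => (u1 <* inv_val t) *> u2).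
Proof.
split=> [x x' y|x y y'|x b y]; first by rewrite lactDl ractDl.
  by rewrite ractDr.
by rewrite -lactA invE lractA ractA.
Qed.

Lemma inv_mulE (t : tens_inv) (x y : A) :
  inv_mul t (x \oxB y) = (x <* inv_val t) *> y.
Proof. by exact: tens_liftE (inv_mul_bal t). Qed.

Lemma inv_mulD (t : tens_inv) : {morph inv_mul t : x y / x + y}.
Proof. by apply: tens_liftD; exact: inv_mul_bal. Qed.

Lemma inv_mul_lact t a x : inv_mul t (a <* x) = a <* inv_mul t x.
Proof.
elim/(@tens_ind A B A ABB BBA): x => [x y|x y IHx IHy].
  by rewrite oxl !inv_mulE lractA lactA.
by rewrite lactDr !inv_mulD IHx IHy lactDr.
Qed.

Lemma inv_mul_ract t a x : inv_mul t (x *> a) = inv_mul t x *> a.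
Proof.
elim/(@tens_ind A B A ABB BBA): x => [x y|x y IHx IHy].
  by rewrite oxr !inv_mulE ractA.
by rewrite ractDl !inv_mulD IHx IHy ractDl.
Qed.

Lemma inv_mul_inv t (u : tens_inv) : inv_mul t (inv_val u) \in inv_pred.
Proof.
by apply/inv_predP => b; rewrite -inv_mul_lact invE inv_mul_ract.
Qed.

Definition inv_mulr (t u : tens_inv) : tens_inv := TensInv (inv_mul_inv t u).

Lemma pure_cent_inv (r s : A) : r \in cent_pred -> s \in cent_pred ->
  r \oxB s \in inv_pred.
Proof.
move=> /cent_predP hr /cent_predP hs; apply/inv_predP => b.
by rewrite oxl oxr hr oxA hs.
Qed.

Lemma one_cent : 1 \in cent_pred.
Proof. by apply/cent_predP => b; rewrite mulr1 mul1r. Qed.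

Definition inv_oner : tens_inv := TensInv (pure_cent_inv one_cent one_cent).

Lemma inv_mulrA : associative inv_mulr.
Proof.
move=> t u w; apply: val_inj => /=.
elim/(@tens_ind A B A ABB BBA): (inv_val w) => [x y|x y IHx IHy].
  by rewrite !inv_mulE inv_mul_ract inv_mul_lact.
by rewrite !inv_mulD IHx IHy.
Qed.

Lemma inv_mul1r : left_id inv_oner inv_mulr.
Proof.
move=> t; apply: val_inj => /=.
elim/(@tens_ind A B A ABB BBA): (inv_val t) => [x y|x y IHx IHy].
  by rewrite inv_mulE /= oxl oxr /= mulr1 mul1r.
by rewrite inv_mulD IHx IHy.
Qed.

Lemma inv_mulr1 : right_id inv_oner inv_mulr.
Proof. by move=> t; apply: val_inj; rewrite /= inv_mulE lact1 ract1. Qed.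

Lemma inv_mulrDl : left_distributive inv_mulr +%R.
Proof.
move=> t u w; apply: val_inj => /=.
elim/(@tens_ind A B A ABB BBA): (inv_val w) => [x y|x y IHx IHy].
  by rewrite !inv_mulE /= lactDr ractDl.
by rewrite !inv_mulD IHx IHy addrACA.
Qed.

Lemma inv_mulrDr : right_distributive inv_mulr +%R.
Proof. by move=> t u w; apply: val_inj; rewrite /= inv_mulD. Qed.

HB.instance Definition _ := GRing.Zmodule_isPzRing.Build tens_inv
  inv_mulrA inv_mul1r inv_mulr1 inv_mulrDl inv_mulrDr.

Definition D2_src (r : centralizer) : tens_inv :=
  TensInv (pure_cent_inv one_cent (cent_valP r)).

Definition D2_tgt (r : centralizer) : tens_inv :=
  TensInv (pure_cent_inv (cent_valP r) one_cent).

Lemma D2_src_zmod : zmod_morphism D2_src.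
Proof.
move=> r s; apply: val_inj => /=; apply: (addIr (1 \oxB cent_val s)).
by rewrite -pureDr !subrK.
Qed.

Lemma D2_src_monoid : monoid_morphism D2_src.
Proof.
split=> [|r s]; apply: val_inj => //=.
by rewrite inv_mulE lact1 oxr.
Qed.

HB.instance Definition _ :=
  GRing.isZmodMorphism.Build centralizer tens_inv D2_src D2_src_zmod.
HB.instance Definition _ :=
  GRing.isMonoidMorphism.Build centralizer tens_inv D2_src D2_src_monoid.

Definition inv_scal (a : k) : tens_inv := D2_src (cent_scal a).

Lemma inv_scalC a (t : tens_inv) : inv_scal a * t = t * inv_scal a.
Proof.
apply: val_inj => /=; rewrite inv_mulE lact1.
elim/(@tens_ind A B A ABB BBA): (inv_val t) => [x y|x y IHx IHy].
  by rewrite inv_mulE /= oxl !oxr /= mulr1 scalC.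
by rewrite inv_mulD IHx IHy ractDl.
Qed.

Lemma inv_scal_zmod : zmod_morphism inv_scal.
Proof. by move=> a b; rewrite /inv_scal !rmorphB. Qed.

Lemma inv_scal_monoid : monoid_morphism inv_scal.
Proof. by split=> [|a b]; rewrite /inv_scal ?rmorph1 ?rmorphM. Qed.

HB.instance Definition _ :=
  GRing.isZmodMorphism.Build k tens_inv inv_scal inv_scal_zmod.
HB.instance Definition _ :=
  GRing.isMonoidMorphism.Build k tens_inv inv_scal inv_scal_monoid.

HB.instance Definition _ := isPzAlgebra.Build k tens_inv inv_scalC.

Definition D2_src_hom : algHom centralizer tens_inv :=
  @AlgHom k centralizer tens_inv D2_src (fun=> erefl).

Lemma D2_tgt_antihom : @alg_antihom k centralizer tens_inv D2_tgt.
Proof.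
split=> [r s|r s|a]; apply: val_inj => /=; first by rewrite pureDl.
  by rewrite inv_mulE ract1 oxl.
have := oxA 1 (scal a) 1.
by rewrite alg_hom_scal mul1r mulr1.
Qed.

Lemma D2_src_tgtC r s : D2_src r * D2_tgt s = D2_tgt s * D2_src r.
Proof.
apply: val_inj; rewrite /= !inv_mulE ract1 lact1 oxl oxr /=.
by rewrite mulr1 mul1r.
Qed.

Definition D2_base : bialg_base centralizer tens_inv :=
  @BialgBase k centralizer tens_inv D2_src_hom D2_tgt D2_tgt_antihom D2_src_tgtC.

Lemma D2_lactE (r : centralizer) (t : baseB D2_base) :
  inv_val (r <* t) = cent_val r <* inv_val t.
Proof. by rewrite /= inv_mulE ract1. Qed.

Lemma D2_ractE (r : centralizer) (t : baseB D2_base) :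
  inv_val (t *> r) = inv_val t *> cent_val r.
Proof. by rewrite /= inv_mulE lact1. Qed.

(* t^1 t^2 *)
Definition tens_mul : AoA -> A :=
  @tens_lift A B A ABB BBA A (fun t1 t2 : A => t1 * t2).

Lemma tens_mul_bal : @balanced A B A ABB BBA A (fun t1 t2 : A => t1 * t2).
Proof.
split=> [x x' y|x y y'|x b y] /=; first by rewrite mulrDl.
  by rewrite mulrDr.
by rewrite mulrA.
Qed.

Lemma tens_mulE x y : tens_mul (x \oxB y) = x * y.
Proof. exact: tens_liftE tens_mul_bal. Qed.

Lemma tens_mulD : {morph tens_mul : x y / x + y}.
Proof. exact: tens_liftD tens_mul_bal. Qed.

Lemma tens_mul_lact a x : tens_mul (a <* x) = a * tens_mul x.
Proof.
elim/(@tens_ind A B A ABB BBA): x => [x y|x y IHx IHy].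
  by rewrite oxl !tens_mulE /= mulrA.
by rewrite lactDr !tens_mulD IHx IHy mulrDr.
Qed.

Lemma tens_mul_ract a x : tens_mul (x *> a) = tens_mul x * a.
Proof.
elim/(@tens_ind A B A ABB BBA): x => [x y|x y IHx IHy].
  by rewrite oxr !tens_mulE /= mulrA.
by rewrite ractDl !tens_mulD IHx IHy mulrDl.
Qed.

Lemma D2_eps_cent (t : tens_inv) : tens_mul (inv_val t) \in cent_pred.
Proof.
by apply/cent_predP => b; rewrite -tens_mul_lact invE tens_mul_ract.
Qed.

Definition D2_eps (t : tens_inv) : centralizer := Centralizer (D2_eps_cent t).

Section EndMaps.
Context (g : bimodHom BAB BAB).

Lemma endoD : {morph (g : A -> A) : x y / x + y}.
Proof. by case: (bimod_homP g). Qed.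

Lemma endoMl b x : g (f b * x) = f b * g x.
Proof. by case: (bimod_homP g) => _ gl _; exact: (gl b x). Qed.

Lemma endoMr x b : g (x * f b) = g x * f b.
Proof. by case: (bimod_homP g) => _ _ gr; exact: (gr x b). Qed.

(* t^1 \ox g(t^2) and g(t^1) \ox t^2 *)
Definition endo_r : AoA -> AoA := @tens_map A B A A B A ABB BBA ABB BBA id g.
Definition endo_l : AoA -> AoA := @tens_map A B A A B A ABB BBA ABB BBA g id.

Lemma endo_r_bal :
  @balanced A B A ABB BBA AoA (fun x y : A => x \oxB g y).
Proof.
split=> [x x' y|x y y'|x b y]; first by rewrite pureDl.
  by rewrite endoD pureDr.
by rewrite oxA -endoMl.
Qed.

Lemma endo_l_bal :
  @balanced A B A ABB BBA AoA (fun x y : A => g x \oxB y).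
Proof.
split=> [x x' y|x y y'|x b y]; first by rewrite endoD pureDl.
  by rewrite pureDr.
by rewrite endoMr oxA.
Qed.

Lemma endo_rE x y : endo_r (x \oxB y) = x \oxB g y.
Proof. exact: tens_liftE endo_r_bal. Qed.

Lemma endo_lE x y : endo_l (x \oxB y) = g x \oxB y.
Proof. exact: tens_liftE endo_l_bal. Qed.

Lemma endo_rD : {morph endo_r : x y / x + y}.
Proof. exact: tens_liftD endo_r_bal. Qed.

Lemma endo_lD : {morph endo_l : x y / x + y}.
Proof. exact: tens_liftD endo_l_bal. Qed.

Lemma endo_r_inv (t : tens_inv) : endo_r (inv_val t) \in inv_pred.
Proof.
have El b x : endo_r (f b <* x) = f b <* endo_r x.
  elim/(@tens_ind A B A ABB BBA): x => [x y|x y IHx IHy].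
    by rewrite endo_rE !oxl endo_rE.
  by rewrite lactDr !endo_rD lactDr IHx IHy.
have Er b x : endo_r (x *> f b) = endo_r x *> f b.
  elim/(@tens_ind A B A ABB BBA): x => [x y|x y IHx IHy].
    by rewrite endo_rE !oxr endo_rE endoMr.
  by rewrite ractDl !endo_rD ractDl IHx IHy.
by apply/inv_predP => b; rewrite -El invE Er.
Qed.

Lemma endo_l_inv (t : tens_inv) : endo_l (inv_val t) \in inv_pred.
Proof.
have El b x : endo_l (f b <* x) = f b <* endo_l x.
  elim/(@tens_ind A B A ABB BBA): x => [x y|x y IHx IHy].
    by rewrite endo_lE !oxl endo_lE endoMl.
  by rewrite lactDr !endo_lD lactDr IHx IHy.
have Er b x : endo_l (x *> f b) = endo_l x *> f b.
  elim/(@tens_ind A B A ABB BBA): x => [x y|x y IHx IHy].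
    by rewrite endo_lE !oxr endo_lE.
  by rewrite ractDl !endo_lD ractDl IHx IHy.
by apply/inv_predP => b; rewrite -El invE Er.
Qed.

Definition inv_endo_r (t : tens_inv) : tens_inv := TensInv (endo_r_inv t).
Definition inv_endo_l (t : tens_inv) : tens_inv := TensInv (endo_l_inv t).

End EndMaps.

Local Open Scope classical_set_scope.

Record right_quasibasis (I : choiceType) (u : I -> tens_inv)
    (gam : I -> bimodHom BAB BAB) : Prop := {
  right_qb_fin : forall a : A, finite_set [set i | gam i a <> 0 :> A];
  right_qbE : forall x y : A,
    x \oxB y = \sum_(i \in [set: I]) (x * gam i y) <* inv_val (u i)
}.

Record left_quasibasis (I : choiceType) (t : I -> tens_inv)
    (bet : I -> bimodHom BAB BAB) : Prop := {
  left_qb_fin : forall a : A, finite_set [set i | bet i a <> 0 :> A];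
  left_qbE : forall x y : A,
    x \oxB y = \sum_(i \in [set: I]) inv_val (t i) *> (bet i x * y)
}.

Lemma right_D2_quasibasis : right_D2 ->
  exists (I : choiceType) (u : I -> tens_inv) (gam : I -> bimodHom BAB BAB),
    right_quasibasis u gam.
Proof.
case=> I /direct_summandP[p [q [[pD pl pr] [qD ql qr] pK]]].
pose e i : dsumB I ABB := << (1 : A) *g i >>.
have qE b i : f b <* (q (e i) : AoA) = (q (e i) : AoA) *> f b.
  rewrite -[LHS](ql (f b)) -[RHS](qr _ b); congr q; apply/malgP => j.
  rewrite dsum_lactE dsum_ractE !mcoeffU.
  suff : f b * (1 *+ (i == j)) = (1 *+ (i == j)) * f b :> A by [].
  by case: (i == j); rewrite ?mulr1n ?mulr0n ?mulr0 ?mul0r ?mulr1 ?mul1r.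
have qinv i : (q (e i) : AoA) \in inv_pred by apply/inv_predP => b; exact: qE.
pose g i (y : A) : A := (p (1 \oxB y) : {malg A[I]})@_i.
have pcl a z i : (p (a <* (z : AoA)) : {malg A[I]})@_i =
    a * (p z : {malg A[I]})@_i.
  by rewrite (pl a z); exact: (@dsum_lactE A B I ABB a (p z) i).
have pcr z b i : (p ((z : AoA) *> f b) : {malg A[I]})@_i =
    (p z : {malg A[I]})@_i * f b.
  by rewrite (pr z b); exact: (@dsum_ractE A B I ABB (p z) b i).
have gD i : {morph g i : x y / x + y}.
  by move=> x y; rewrite /g pureDr pD mcoeffD.
have gl i b x : g i (f b * x) = f b * g i x.
  by rewrite /g -pcl oxl mulr1 -oxA mul1r.
have gr i x b : g i (x * f b) = g i x * f b.
  by rewrite /g -pcr oxr.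
have gh i : @bimod_hom B B BAB BAB (g i).
  by split; [exact: gD | exact: gl | exact: gr].
exists I, (fun i => TensInv (qinv i)), (fun i => BimodHom (gh i)); split.
  move=> a; apply: (@sub_finite_set _ _ [set` msupp (p (1 \oxB a) : {malg A[I]})]).
    by move=> i /= /eqP; rewrite /g mcoeff_neq0.
  exact: finite_fset.
move=> x y; pose s := msupp (p (1 \oxB y) : {malg A[I]}).
have q0 : q 0 = 0 by apply: (addrI (q 0)); rewrite -qD !addr0.
rewrite (fsbigE (s : seq I)); [| exact: fset_uniq | by [] | ]; last first.
  move=> i _ /mcoeff_outdom gi0; rewrite [_ (BimodHom _) _](gi0 : g i y = 0).
  by rewrite mulr0 lact0l.
have -> : x \oxB y = x <* (q (p (1 \oxB y)) : AoA).
  by rewrite pK oxl mulr1.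
rewrite [p _ in LHS]monalgE -/s (big_morph q qD q0).
rewrite (big_morph (lact (x : A) : AoA -> AoA) (lactDr x) (lact0 _ x)).
rewrite [RHS]big_mkcond; apply: eq_bigr => i _; rewrite in_setT -lactA.
apply: (congr1 (lact (x : A) : AoA -> AoA)); rewrite -[RHS](ql (g i y));
  congr q; apply/malgP => j.
rewrite dsum_lactE !mcoeffU.
suff : g i y *+ (i == j) = g i y * (1 *+ (i == j)) by [].
by rewrite mulrnAr mulr1.
Qed.

Lemma left_D2_quasibasis : left_D2 ->
  exists (I : choiceType) (t : I -> tens_inv) (bet : I -> bimodHom BAB BAB),
    left_quasibasis t bet.
Proof.
case=> I /direct_summandP[p [q [[pD pl pr] [qD ql qr] pK]]].
pose e i : dsumB I BBA := << (1 : A) *g i >>.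
have qE b i : f b <* (q (e i) : AoA) = (q (e i) : AoA) *> f b.
  rewrite -[LHS](ql b) -[RHS](qr _ (f b)); congr q; apply/malgP => j.
  rewrite dsum_lactE dsum_ractE !mcoeffU.
  suff : f b * (1 *+ (i == j)) = (1 *+ (i == j)) * f b :> A by [].
  by case: (i == j); rewrite ?mulr1n ?mulr0n ?mulr0 ?mul0r ?mulr1 ?mul1r.
have qinv i : (q (e i) : AoA) \in inv_pred by apply/inv_predP => b; exact: qE.
pose g i (x : A) : A := (p (x \oxB 1) : {malg A[I]})@_i.
have pcl b z i : (p (f b <* (z : AoA)) : {malg A[I]})@_i =
    f b * (p z : {malg A[I]})@_i.
  by rewrite (pl b z); exact: (@dsum_lactE B A I BBA b (p z) i).
have pcr z a i : (p ((z : AoA) *> a) : {malg A[I]})@_i =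
    (p z : {malg A[I]})@_i * a.
  by rewrite (pr z a); exact: (@dsum_ractE B A I BBA (p z) a i).
have gD i : {morph g i : x y / x + y}.
  by move=> x y; rewrite /g pureDl pD mcoeffD.
have gl i b x : g i (f b * x) = f b * g i x.
  by rewrite /g -pcl oxl.
have gr i x b : g i (x * f b) = g i x * f b.
  by rewrite /g -pcr oxr mul1r oxA mulr1.
have gh i : @bimod_hom B B BAB BAB (g i).
  by split; [exact: gD | exact: gl | exact: gr].
exists I, (fun i => TensInv (qinv i)), (fun i => BimodHom (gh i)); split.
  move=> a; apply: (@sub_finite_set _ _ [set` msupp (p (a \oxB 1) : {malg A[I]})]).
    by move=> i /= /eqP; rewrite /g mcoeff_neq0.
  exact: finite_fset.
move=> x y; pose s := msupp (p (x \oxB 1) : {malg A[I]}).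
have q0 : q 0 = 0 by apply: (addrI (q 0)); rewrite -qD !addr0.
rewrite (fsbigE (s : seq I)); [| exact: fset_uniq | by [] | ]; last first.
  move=> i _ /mcoeff_outdom gi0; rewrite [_ (BimodHom _) _](gi0 : g i x = 0).
  by rewrite mul0r ract0r.
have -> : x \oxB y = (q (p (x \oxB 1)) : AoA) *> y.
  by rewrite pK oxr mul1r.
rewrite [p _ in LHS]monalgE -/s (big_morph q qD q0).
rewrite (big_morph ((@ract _ _ AoA)^~ (y : A)) (fun m n => ractDl m n y) (ract0 _ y)).
rewrite [RHS]big_mkcond; apply: eq_bigr => i _; rewrite in_setT -ractA.
apply: (congr1 ((@ract _ _ AoA)^~ (y : A))); rewrite -[RHS](qr _ (g i x)).
congr q; apply/malgP => j; rewrite dsum_ractE !mcoeffU.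
suff : g i x *+ (i == j) = (1 *+ (i == j)) * g i x by [].
by rewrite mulrnAl mul1r.
Qed.

Local Notation TB := (baseB D2_base).
Local Notation "t \oxR u" :=
  (@pure centralizer centralizer centralizer TB TB t u)
  (at level 40, left associativity).

(* When A is right or left D2, at most one map Delta is a D2 comultiplication,
   since a quasibasis exists by right_D2_quasibasis or left_D2_quasibasis. *)
Record is_D2_comul (Delta : tens_inv -> tens TB TB) : Prop := {
  comul_right : forall (I : choiceType) u (gam : I -> bimodHom BAB BAB),
    right_quasibasis u gam -> forall t,
    Delta t = \sum_(i \in [set: I]) inv_endo_r (gam i) t \oxR u i;
  comul_left : forall (I : choiceType) ti (bet : I -> bimodHom BAB BAB),
    left_quasibasis ti bet -> forall t,
    Delta t = \sum_(i \in [set: I]) ti i \oxR inv_endo_l (bet i) t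
}.

End Extension.

(* Main.v *)
Require Import Defs.
From mathcomp Require Import all_boot all_algebra.
From mathcomp Require Import finmap boolp classical_sets cardinality fsbigop.

(** Let glue : T \ox_R T -> A \ox_B A \ox_B A be the map
    t \ox u |-> t^1 \ox t^2 u^1 \ox u^2.  The comultiplication is characterised,
    without any choice of quasibasis, by glue (Delta t) = t^1 \ox 1 \ox t^2:
    a right quasibasis writes 1 \ox y as \sum_i gam_i(y) u_i, hence
    t^1 \ox 1 \ox t^2 as the glued image of \sum_i (t^1 \ox gam_i(t^2)) \ox u_i,
    and a left quasibasis does the same from the other side
    (right_qb_glue_comul, left_qb_glue_comul).

    What depth two provides beyond existence is the injectivity of glue
    (right_qb_glue_inj, left_qb_glue_inj).  In the right case, t^1 gam_i(t^2)
    lies in R for t in T, and t = \sum_i t^1 gam_i(t^2) u_i, so the u_i and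
    these functionals form a dual basis of T as a left R-module.  An element of
    T \ox_R T is therefore determined by its contractions
    t \ox u |-> t u^1 gam_i(u^2), and these can be computed after gluing.  The
    left case is the mirror image.

    By injectivity, the identities between elements of T \ox_R T are checked
    after gluing, where Delta t has become t^1 \ox 1 \ox t^2 and both sides can
    be evaluated (coproduct_bimod, coproduct_takeuchi, coproductM); the counit
    laws follow by multiplying two adjacent factors.  Coassociativity lives in a
    triple tensor product over R, but contracting an outer factor with the dual
    basis brings it back to T \ox_R T, where it says that
    Delta (t^1 \ox gam_i(t^2)) equals t_(1) \ox gam_i(t_(2)): both
    represent t^1 \ox 1 \ox gam_i(t^2). *)

Set Implicit Arguments.
Unset Strict Implicit.
Unset Printing Implicit Defensive.

Import GRing.Theory.
Local Open Scope ring_scope.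
Local Open Scope classical_set_scope.

(** * Sums of pointwise finite families *)

Definition pointwise_finite (I : choiceType) (V W : zmodType)
    (F : I -> V -> W) : Prop :=
  forall v, finite_set [set i | F i v <> 0].

Lemma fsum_supp (I : choiceType) (W : zmodType) (G : I -> W) (D : set I) :
  finite_set D -> (forall i, G i <> 0 -> D i) ->
  \sum_(i \in [set: I]) G i = \sum_(i <- fset_set D) G i.
Proof.
move=> finD GD; apply: fsbigTE => i; rewrite in_fset_set // => /negP Di.
by apply: contrapT => /GD; rewrite -in_setE.
Qed.

Lemma morph0 (V W : zmodType) (h : V -> W) :
  {morph h : x y / x + y} -> h 0 = 0.
Proof. by move=> hD; apply: (addrI (h 0)); rewrite -hD !addr0. Qed.

Lemma morph_sum (V W : zmodType) (h : V -> W) (J : Type) (s : seq J)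
    (G : J -> V) : {morph h : x y / x + y} ->
  h (\sum_(j <- s) G j) = \sum_(j <- s) h (G j).
Proof. by move=> hD; rewrite (big_morph h hD (morph0 hD)). Qed.

Section PointwiseFinite.
Context (I : choiceType) (V W : zmodType).
Implicit Type F : I -> V -> W.

Lemma fsum_morph (h : V -> W) (G : I -> V) : {morph h : x y / x + y} ->
  finite_set [set i | G i <> 0] ->
  h (\sum_(i \in [set: I]) G i) = \sum_(i \in [set: I]) h (G i).
Proof.
move=> hD finG; rewrite (fsum_supp finG) // (morph_sum _ _ hD).
rewrite (fsum_supp finG) //.
by move=> i hG /= G0; apply: hG; rewrite G0 (morph0 hD).
Qed.

(** The supports of F x and F y differ, but both lie in one finite set. *)
Lemma fsumD F : (forall i, {morph F i : x y / x + y}) -> pointwise_finite F ->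
  {morph (fun v => \sum_(i \in [set: I]) F i v) : x y / x + y}.
Proof.
move=> FD finF x y.
pose D : set I := [set i | F i x <> 0] `|` [set i | F i y <> 0].
have finD : finite_set D by rewrite finite_setU.
rewrite !(fsum_supp finD).
- by rewrite -big_split; apply: eq_bigr => i _; exact: FD.
- by move=> i; right.
- by move=> i; left.
move=> i; rewrite FD => Fi; apply: contrapT.
move=> /not_orP[/contrapT Fx /contrapT Fy].
by apply: Fi; rewrite Fx Fy addr0.
Qed.

Lemma pointwise_finite_tens (P Q S : pzRingType) (M : bimod P Q)
    (N : bimod Q S) (F : I -> tens M N -> W) :
  (forall i, {morph F i : x y / x + y}) ->
  (forall m n, finite_set [set i | F i (m \ox n) <> 0]) -> pointwise_finite F.
Proof.
move=> FD Fp; elim/tens_ind => [|x y Fx Fy]; first exact: Fp.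
apply: (@sub_finite_set _ _ ([set i | F i x <> 0] `|` [set i | F i y <> 0])).
  move=> i /=; rewrite FD => Fi; apply: contrapT.
  move=> /not_orP[/contrapT Fx0 /contrapT Fy0].
  by apply: Fi; rewrite Fx0 Fy0 addr0.
by rewrite finite_setU.
Qed.

End PointwiseFinite.

(** * Tensor products of bimodules *)

Section TensorMorphisms.
Context (P Q S : pzRingType) (M : bimod P Q) (N : bimod Q S).

Section Left.
Context (P' : pzRingType) (M' : bimod P' Q) (g : M -> M').
Hypotheses (gD : {morph g : x y / x + y})
  (gr : forall m a, g (m *> a) = g m *> a).

Lemma tens_mapl_bal : balanced (fun m (n : N) => g m \ox n).
Proof.
split=> [m m' n|m n n'|m a n]; first by rewrite gD pureDl.
  by rewrite pureDr.
by rewrite gr pureA.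
Qed.

Lemma tens_maplE m (n : N) : tens_map g id (m \ox n) = g m \ox n.
Proof. exact: tens_liftE tens_mapl_bal. Qed.

Lemma tens_maplD : {morph (tens_map g id : tens M N -> _) : x y / x + y}.
Proof. exact: tens_liftD tens_mapl_bal. Qed.
End Left.

Section Right.
Context (S' : pzRingType) (N' : bimod Q S') (h : N -> N').
Hypotheses (hD : {morph h : x y / x + y})
  (hl : forall a n, h (a <* n) = a <* h n).

Lemma tens_mapr_bal : balanced (fun (m : M) n => m \ox h n).
Proof.
split=> [m m' n|m n n'|m a n]; first by rewrite pureDl.
  by rewrite hD pureDr.
by rewrite pureA hl.
Qed.

Lemma tens_maprE (m : M) n : tens_map id h (m \ox n) = m \ox h n.
Proof. exact: tens_liftE tens_mapr_bal. Qed.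

Lemma tens_maprD : {morph (tens_map id h : tens M N -> _) : x y / x + y}.
Proof. exact: tens_liftD tens_mapr_bal. Qed.
End Right.
End TensorMorphisms.

Lemma tens_sum_pure (P Q S : pzRingType) (M : bimod P Q) (N : bimod Q S)
  (x : tens M N) : exists s : seq (M * N), x = \sum_(p <- s) p.1 \ox p.2.
Proof.
elim/tens_ind: x => [m n|x y [s ->] [s' ->]].
  by exists [:: (m, n)]; rewrite big_seq1.
by exists (s ++ s'); rewrite big_cat.
Qed.

Section Associativity.
Context (P Q S U : pzRingType) (L : bimod P Q) (M : bimod Q S) (N : bimod S U).

Lemma tens_assoc_inner_bal n :
  balanced (fun (l : L) m => l \ox ((m \ox n) : tensB M N)).
Proof.
split=> [l l' m|l m m'|l a m]; first by rewrite pureDl.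
  by rewrite pureDl pureDr.
by rewrite pureA lact_pure.
Qed.

Lemma tens_assoc_bal : balanced (fun (x : tensB L M) n =>
  tens_lift (fun l m => l \ox ((m \ox n) : tensB M N)) x).
Proof.
split=> [x x' n|x n n'|x a n].
- exact: tens_liftD (tens_assoc_inner_bal n) x x'.
- elim/(@tens_ind P Q S L M): x => [l m|x y IHx IHy].
    rewrite !(tens_liftE _ _ (tens_assoc_inner_bal _)).
    by rewrite pureDr pureDr.
  by rewrite !(tens_liftD (tens_assoc_inner_bal _)) IHx IHy addrACA.
- elim/(@tens_ind P Q S L M): x => [l m|x y IHx IHy].
    rewrite ract_pure !(tens_liftE _ _ (tens_assoc_inner_bal _)).
    by rewrite pureA.
  by rewrite ractDl !(tens_liftD (tens_assoc_inner_bal _)) IHx IHy.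
Qed.

Lemma tens_assocE l m n :
  tens_assoc (((l \ox m) : tensB L M) \ox n) = l \ox ((m \ox n) : tensB M N).
Proof.
rewrite /tens_assoc (tens_liftE _ _ tens_assoc_bal).
exact: tens_liftE (tens_assoc_inner_bal n).
Qed.

Lemma tens_assocD :
  {morph @tens_assoc P Q S U L M N : x y / x + y}.
Proof. exact: tens_liftD tens_assoc_bal. Qed.

Lemma tens_assoc_surj (y : tens L (tensB M N)) : exists x, tens_assoc x = y.
Proof.
elim/tens_ind: y => [l|y y' [x <-] [x' <-]]; last first.
  by exists (x + x'); rewrite tens_assocD.
elim/(@tens_ind Q S U M N) => [m n|w w' [x xE] [x' xE']].
  by exists (((l \ox m) : tensB L M) \ox n); rewrite tens_assocE.
by exists (x + x'); rewrite tens_assocD xE xE' -pureDr.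
Qed.
End Associativity.

(** * Contractions and dual bases *)

Section ContractR.
Context (P Q S : pzRingType) (M : bimod P Q) (N : bimod Q S) (lam : N -> Q).
Hypotheses (lD : {morph lam : x y / x + y})
  (ll : forall a n, lam (a <* n) = a * lam n).

Definition contract_r : tens M N -> M := tens_lift (fun m n => m *> lam n).

Lemma contract_r_bal : balanced (fun (m : M) n => m *> lam n).
Proof.
split=> [m m' n|m n n'|m a n]; first by rewrite ractDl.
  by rewrite lD ractDr.
by rewrite ractA ll.
Qed.

Lemma contract_rE m n : contract_r (m \ox n) = m *> lam n.
Proof. exact: tens_liftE contract_r_bal. Qed.

Lemma contract_rD : {morph contract_r : x y / x + y}.
Proof. exact: tens_liftD contract_r_bal. Qed.

Lemma contract_r_lact a (x : tensB M N) :
  contract_r (a <* x) = a <* contract_r x.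
Proof.
elim/(@tens_ind P Q S M N): x => [m n|x y IHx IHy].
  by rewrite lact_pure !contract_rE lractA.
by rewrite lactDr !contract_rD IHx IHy lactDr.
Qed.
End ContractR.

Section ContractL.
Context (P Q S : pzRingType) (M : bimod P Q) (N : bimod Q S) (lam : M -> Q).
Hypotheses (lD : {morph lam : x y / x + y})
  (lr : forall m a, lam (m *> a) = lam m * a).

Definition contract_l : tens M N -> N := tens_lift (fun m n => lam m <* n).

Lemma contract_l_bal : balanced (fun m (n : N) => lam m <* n).
Proof.
split=> [m m' n|m n n'|m a n]; first by rewrite lD lactDl.
  by rewrite lactDr.
by rewrite lactA lr.
Qed.

Lemma contract_lE m n : contract_l (m \ox n) = lam m <* n.
Proof. exact: tens_liftE contract_l_bal. Qed.

Lemma contract_lD : {morph contract_l : x y / x + y}.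
Proof. exact: tens_liftD contract_l_bal. Qed.

Lemma contract_l_ract a (x : tensB M N) :
  contract_l (x *> a) = contract_l x *> a.
Proof.
elim/(@tens_ind P Q S M N): x => [m n|x y IHx IHy].
  by rewrite ract_pure !contract_lE lractA.
by rewrite ractDl !contract_lD IHx IHy ractDl.
Qed.
End ContractL.

Lemma contract_r_map (P P' Q S : pzRingType) (M : bimod P Q) (M' : bimod P' Q)
    (N : bimod Q S) (lam : N -> Q) (g : M -> M') :
  {morph lam : x y / x + y} -> (forall a n, lam (a <* n) = a * lam n) ->
  {morph g : x y / x + y} -> (forall m a, g (m *> a) = g m *> a) ->
  forall x, contract_r lam (tens_map g id x) = g (contract_r lam x).
Proof.
move=> lD ll gD gr; elim/tens_ind => [m n|x y IHx IHy].
  by rewrite (tens_maplE gD gr) !contract_rE // gr.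
by rewrite (tens_maplD gD gr) !contract_rD // IHx IHy gD.
Qed.

Lemma contract_l_map (P Q S S' : pzRingType) (M : bimod P Q) (N : bimod Q S)
    (N' : bimod Q S') (lam : M -> Q) (h : N -> N') :
  {morph lam : x y / x + y} -> (forall m a, lam (m *> a) = lam m * a) ->
  {morph h : x y / x + y} -> (forall a n, h (a <* n) = a <* h n) ->
  forall x, contract_l lam (tens_map id h x) = h (contract_l lam x).
Proof.
move=> lD lr hD hl; elim/tens_ind => [m n|x y IHx IHy].
  by rewrite (tens_maprE hD hl) !contract_lE // hl.
by rewrite (tens_maprD hD hl) !contract_lD // IHx IHy hD.
Qed.

Lemma contract_r_assoc (P Q S U : pzRingType) (L : bimod P Q) (M : bimod Q S)
    (N : bimod S U) (lam : N -> S) :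
  {morph lam : x y / x + y} -> (forall a n, lam (a <* n) = a * lam n) ->
  forall x : tens (tensB L M) N,
  tens_map id (contract_r lam : tensB M N -> M) (tens_assoc x) =
  contract_r lam x.
Proof.
move=> lD ll; have cD : {morph (contract_r lam : tensB M N -> M) : x y / x + y}.
  exact: contract_rD.
have cl := @contract_r_lact _ _ _ M N _ lD ll.
elim/tens_ind => [y n|x y IHx IHy]; last first.
  by rewrite tens_assocD (tens_maprD cD cl) IHx IHy contract_rD.
rewrite contract_rE //.
elim/(@tens_ind P Q S L M): y => [l m|x y IHx IHy].
  by rewrite tens_assocE (tens_maprE cD cl) contract_rE // ract_pure.
by rewrite pureDl tens_assocD (tens_maprD cD cl) IHx IHy ractDl.
Qed.

Lemma contract_l_assoc (P Q S U : pzRingType) (L : bimod P Q) (M : bimod Q S)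
    (N : bimod S U) (lam : L -> Q) :
  {morph lam : x y / x + y} -> (forall l a, lam (l *> a) = lam l * a) ->
  forall x : tens (tensB L M) N,
  contract_l lam (tens_assoc x) =
  tens_map (contract_l lam : tensB L M -> M) id x.
Proof.
move=> lD lr; have cD : {morph (contract_l lam : tensB L M -> M) : x y / x + y}.
  exact: contract_lD.
have cr m a := @contract_l_ract _ _ _ L M _ lD lr a m.
elim/tens_ind => [y n|x y IHx IHy]; last first.
  by rewrite tens_assocD (tens_maplD cD cr) -IHx -IHy contract_lD.
rewrite (tens_maplE cD cr).
elim/(@tens_ind P Q S L M): y => [l m|x y IHx IHy].
  by rewrite tens_assocE !contract_lE // lact_pure.
by rewrite pureDl tens_assocD contract_lD // IHx IHy cD pureDl.
Qed.

Section DualBasis.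
Context (P Q S : pzRingType) (I : choiceType).

(** Finiteness is pointwise, because depth two allows infinite index sets: the
    module need not be finitely generated. *)
Record left_dual_basis (N : bimod Q S) (v : I -> N) (lam : I -> N -> Q) := {
  ldb_add : forall i, {morph lam i : x y / x + y};
  ldb_lin : forall i a n, lam i (a <* n) = a * lam i n;
  ldb_fin : forall n, finite_set [set i | lam i n <> 0];
  ldbE : forall n, n = \sum_(i \in [set: I]) lam i n <* v i
}.

Record right_dual_basis (M : bimod P Q) (v : I -> M) (lam : I -> M -> Q) := {
  rdb_add : forall i, {morph lam i : x y / x + y};
  rdb_lin : forall i m a, lam i (m *> a) = lam i m * a;
  rdb_fin : forall m, finite_set [set i | lam i m <> 0];
  rdbE : forall m, m = \sum_(i \in [set: I]) v i *> lam i m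
}.

Context (M : bimod P Q) (N : bimod Q S).

(** A dual basis of N expands every x in M \ox_Q N as the sum of the
    x_i \ox v_i, where x_i is the contraction of x with lam_i. *)
Lemma contract_r_inj (v : I -> N) lam : left_dual_basis v lam ->
  forall x y : tens M N,
  (forall i, contract_r (lam i) x = contract_r (lam i) y) -> x = y.
Proof.
move=> [lD ll lfin lE].
pose F i (x : tens M N) := contract_r (lam i) x \ox v i.
have FD i : {morph F i : x y / x + y}.
  by move=> x y; rewrite /F contract_rD // pureDl.
have Ffin : pointwise_finite F.
  apply: pointwise_finite_tens => // m n.
  apply: sub_finite_set (lfin n) => i /=.
  rewrite /F contract_rE // => Fi li; apply: Fi.
  by rewrite li ract0r pure0l.
suff E (x : tens M N) : x = \sum_(i \in [set: I]) F i x.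
  by move=> x y xy; rewrite [x]E [y]E; apply: eq_fsbigr => i _; rewrite /F xy.
elim/tens_ind: x => [m n|x y Ex Ey]; last first.
  by rewrite (fsumD FD Ffin) -Ex -Ey.
rewrite {1}[n]lE (fsum_morph (h := pure m)); first last.
- by apply: sub_finite_set (lfin n) => i /= + li; apply; rewrite li lact0l.
- exact: pureDr.
apply: eq_fsbigr => i _.
by rewrite /F contract_rE // pureA.
Qed.

Lemma contract_l_inj (v : I -> M) lam : right_dual_basis v lam ->
  forall x y : tens M N,
  (forall i, contract_l (lam i) x = contract_l (lam i) y) -> x = y.
Proof.
move=> [lD ll lfin lE].
pose F i (x : tens M N) := v i \ox contract_l (lam i) x.
have FD i : {morph F i : x y / x + y}.
  by move=> x y; rewrite /F contract_lD // pureDr.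
have Ffin : pointwise_finite F.
  apply: pointwise_finite_tens => // m n.
  apply: sub_finite_set (lfin m) => i /=.
  rewrite /F contract_lE // => Fi li; apply: Fi.
  by rewrite li lact0l pure0r.
suff E (x : tens M N) : x = \sum_(i \in [set: I]) F i x.
  by move=> x y xy; rewrite [x]E [y]E; apply: eq_fsbigr => i _; rewrite /F xy.
elim/tens_ind: x => [m n|x y Ex Ey]; last first.
  by rewrite (fsumD FD Ffin) -Ex -Ey.
rewrite {1}[m]lE (fsum_morph (h := (@pure _ _ _ M N)^~ n)); first last.
- by apply: sub_finite_set (lfin m) => i /= + li; apply; rewrite li ract0r.
- by move=> x y; exact: pureDl.
apply: eq_fsbigr => i _.
by rewrite /F contract_lE // pureA.
Qed.

End DualBasis.

(** * The map from the tensor square of T to the tensor cube of A *)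

Section DepthTwo.
Context (k : comPzRingType) (B A : pzAlgType k) (f : algHom B A).

Local Notation R := (centralizer f).
Local Notation T := (tens_inv f).
Local Notation AoA := (AoA f).
Local Notation TB := (baseB (D2_base f)).
Local Notation TT := (tensB TB TB).
Local Notation BAoA := (resB f idfun AoA).
Local Notation AAA := (tensB (ABB f) BAoA).
Local Notation "x \oxB y" := (@pure A B A (ABB f) (BBA f) x y)
  (at level 40, left associativity).
Local Notation "x \oxC w" := (@pure A B A (ABB f) BAoA x w)
  (at level 40, left associativity).
Local Notation "t \oxR u" := (@pure R R R TB TB t u)
  (at level 40, left associativity).
Local Notation tens_indB := (@tens_ind A B A (ABB f) (BBA f)).
Local Notation tens_indR := (@tens_ind R R R TB TB).

Lemma oxCA x b w : (x * f b) \oxC w = x \oxC (f b <* w).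
Proof. exact: (@pureA A B A (ABB f) BAoA). Qed.

Lemma oxCl a x w : a <* (x \oxC w : AAA) = (a * x) \oxC w.
Proof. exact: (@lact_pure A B A (ABB f) BAoA). Qed.

Lemma oxCr x w a : (x \oxC w : AAA) *> a = x \oxC (w *> a).
Proof. exact: (@ract_pure A B A (ABB f) BAoA). Qed.

(** x \ox y |-> x \ox y w, the multiplication in the middle factor of
    (A \ox_B A) \ox (A \ox_B A). *)
Definition mul_mid (w : AoA) : AoA -> AAA :=
  @tens_lift A B A (ABB f) (BBA f) AAA (fun x y : A => x \oxC (y <* w)).

Lemma mul_mid_bal w :
  @balanced A B A (ABB f) (BBA f) AAA (fun x y : A => x \oxC (y <* w)).
Proof.
split=> [x x' y|x y y'|x b y]; first by rewrite pureDl.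
  by rewrite lactDl pureDr.
by rewrite oxCA lactA.
Qed.

Lemma mul_midE w x y : mul_mid w (x \oxB y) = x \oxC (y <* w).
Proof. exact: tens_liftE (mul_mid_bal w). Qed.

Lemma mul_midD w : {morph mul_mid w : x y / x + y}.
Proof. exact: tens_liftD (mul_mid_bal w). Qed.

Lemma mul_midDl w w' x : mul_mid (w + w') x = mul_mid w x + mul_mid w' x.
Proof.
elim/tens_indB: x => [x y|x y IHx IHy].
  by rewrite !mul_midE lactDr pureDr.
by rewrite !mul_midD IHx IHy addrACA.
Qed.

Lemma mul_mid_lact w a x : mul_mid w (a <* x) = a <* mul_mid w x.
Proof.
elim/tens_indB: x => [x y|x y IHx IHy].
  by rewrite oxl !mul_midE oxCl.
by rewrite lactDr !mul_midD IHx IHy lactDr.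
Qed.

Lemma mul_mid_ract w a x : mul_mid w (x *> a) = mul_mid (a <* w) x.
Proof.
elim/tens_indB: x => [x y|x y IHx IHy].
  by rewrite oxr !mul_midE lactA.
by rewrite ractDl !mul_midD IHx IHy.
Qed.

Lemma mul_mid_ractr w a x : mul_mid (w *> a) x = mul_mid w x *> a.
Proof.
elim/tens_indB: x => [x y|x y IHx IHy].
  by rewrite !mul_midE oxCr lractA.
by rewrite !mul_midD IHx IHy ractDl.
Qed.

(** t \ox u |-> t^1 \ox t^2 u^1 \ox u^2.  It is injective as soon as A | B is
    depth two on one side, so equations in T \ox_R T can be checked in
    A \ox_B A \ox_B A, where no quasibasis is visible. *)
Definition glue : TT -> AAA :=
  @tens_lift R R R TB TB AAA (fun t u : T => mul_mid (inv_val u) (inv_val t)).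

Lemma glue_bal :
  @balanced R R R TB TB AAA (fun t u : T => mul_mid (inv_val u) (inv_val t)).
Proof.
split=> [t t' u|t u u'|t r u]; first by rewrite mul_midD.
  by rewrite mul_midDl.
by rewrite D2_ractE D2_lactE mul_mid_ract.
Qed.

Lemma glueE (t u : T) : glue (t \oxR u) = mul_mid (inv_val u) (inv_val t).
Proof. exact: tens_liftE glue_bal. Qed.

Lemma glueD : {morph glue : x y / x + y}.
Proof. exact: tens_liftD glue_bal. Qed.

Lemma glue_lact r x : glue (r <* x) = cent_val r <* glue x.
Proof.
elim/tens_indR: x => [t u|x y IHx IHy].
  by rewrite lact_pure !glueE D2_lactE mul_mid_lact.
by rewrite lactDr !glueD IHx IHy lactDr.
Qed.

Lemma glue_ract r x : glue (x *> r) = glue x *> cent_val r.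
Proof.
elim/tens_indR: x => [t u|x y IHx IHy].
  by rewrite ract_pure !glueE D2_ractE mul_mid_ractr.
by rewrite ractDl !glueD IHx IHy ractDl.
Qed.

Definition insert1 : AoA -> AAA :=
  @tens_lift A B A (ABB f) (BBA f) AAA (fun x y : A => x \oxC (1 \oxB y)).

Lemma insert1_bal :
  @balanced A B A (ABB f) (BBA f) AAA (fun x y : A => x \oxC (1 \oxB y)).
Proof.
split=> [x x' y|x y y'|x b y]; first by rewrite pureDl.
  by rewrite [1 \oxB _]pureDr pureDr.
by rewrite oxCA oxl mulr1 -oxA mul1r.
Qed.

Lemma insert1E x y : insert1 (x \oxB y) = x \oxC (1 \oxB y).
Proof. exact: tens_liftE insert1_bal. Qed.

Lemma insert1D : {morph insert1 : x y / x + y}.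
Proof. exact: tens_liftD insert1_bal. Qed.

Lemma insert1_lact a x : insert1 (a <* x) = a <* insert1 x.
Proof.
elim/tens_indB: x => [x y|x y IHx IHy].
  by rewrite oxl !insert1E oxCl.
by rewrite lactDr !insert1D IHx IHy lactDr.
Qed.

Lemma insert1_ract a x : insert1 (x *> a) = insert1 x *> a.
Proof.
elim/tens_indB: x => [x y|x y IHx IHy].
  by rewrite oxr !insert1E oxCr oxr.
by rewrite ractDl !insert1D IHx IHy ractDl.
Qed.

(** The quasibasis-free description of the comultiplication: Delta t is the
    element of T \ox_R T that represents t^1 \ox 1 \ox t^2. *)
Definition is_coproduct (Delta : T -> TT) := forall t,
  glue (Delta t) = insert1 (inv_val t).

Section Contractions.
Context (g : bimodHom (BAB f) (BAB f)).

(** x \ox y \ox z |-> x \ox y g(z). *)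
Definition mul_endo_r : AAA -> AoA :=
  @tens_lift A B A (ABB f) BAoA AoA (fun x w => x \oxB tens_mul (endo_r g w)).

Lemma endo_r_lact a w : endo_r g (a <* w) = a <* endo_r g w.
Proof.
elim/tens_indB: w => [x y|x y IHx IHy].
  by rewrite oxl !endo_rE oxl.
by rewrite lactDr !endo_rD IHx IHy lactDr.
Qed.

Lemma endo_l_ract a w : endo_l g (w *> a) = endo_l g w *> a.
Proof.
elim/tens_indB: w => [x y|x y IHx IHy].
  by rewrite oxr !endo_lE oxr.
by rewrite ractDl !endo_lD IHx IHy ractDl.
Qed.

Lemma mul_endo_r_bal : @balanced A B A (ABB f) BAoA AoA
  (fun x w => x \oxB tens_mul (endo_r g w)).
Proof.
split=> [x x' w|x w w'|x b w]; first by rewrite pureDl.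
  by rewrite endo_rD tens_mulD pureDr.
by rewrite oxA endo_r_lact tens_mul_lact.
Qed.

Lemma mul_endo_rE x w : mul_endo_r (x \oxC w) = x \oxB tens_mul (endo_r g w).
Proof. exact: tens_liftE mul_endo_r_bal. Qed.

Lemma mul_endo_rD : {morph mul_endo_r : x y / x + y}.
Proof. exact: tens_liftD mul_endo_r_bal. Qed.

Lemma mul_endo_r_mid w x :
  mul_endo_r (mul_mid w x) = x *> tens_mul (endo_r g w).
Proof.
elim/tens_indB: x => [x y|x y IHx IHy].
  by rewrite mul_midE mul_endo_rE endo_r_lact tens_mul_lact oxr.
by rewrite mul_midD mul_endo_rD IHx IHy ractDl.
Qed.

Lemma mul_endo_r_insert1 w : mul_endo_r (insert1 w) = endo_r g w.
Proof.
elim/tens_indB: w => [x y|x y IHx IHy].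
  by rewrite insert1E mul_endo_rE !endo_rE tens_mulE mul1r.
by rewrite insert1D mul_endo_rD IHx IHy endo_rD.
Qed.

(** x \ox y \ox z |-> g(x) y \ox z. *)
Definition mul_endo_l : AAA -> AoA :=
  @tens_lift A B A (ABB f) BAoA AoA (fun x w => (g x : A) <* w).

Lemma mul_endo_l_bal : @balanced A B A (ABB f) BAoA AoA
  (fun x w => (g x : A) <* w).
Proof.
split=> [x x' w|x w w'|x b w]; first by rewrite endoD lactDl.
  by rewrite lactDr.
by rewrite [g _]endoMr -lactA.
Qed.

Lemma mul_endo_lE x w : mul_endo_l (x \oxC w) = (g x : A) <* w.
Proof. exact: tens_liftE mul_endo_l_bal. Qed.

Lemma mul_endo_lD : {morph mul_endo_l : x y / x + y}.
Proof. exact: tens_liftD mul_endo_l_bal. Qed.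

Lemma mul_endo_l_mid w x :
  mul_endo_l (mul_mid w x) = tens_mul (endo_l g x) <* w.
Proof.
elim/tens_indB: x => [x y|x y IHx IHy].
  by rewrite mul_midE mul_endo_lE endo_lE tens_mulE lactA.
by rewrite mul_midD mul_endo_lD IHx IHy endo_lD tens_mulD lactDl.
Qed.

Lemma mul_endo_l_insert1 w : mul_endo_l (insert1 w) = endo_l g w.
Proof.
elim/tens_indB: w => [x y|x y IHx IHy].
  by rewrite insert1E mul_endo_lE endo_lE oxl mulr1.
by rewrite insert1D mul_endo_lD IHx IHy endo_lD.
Qed.

End Contractions.

(** * Consequences of quasibases *)

Lemma mul_mid0 v : mul_mid v 0 = 0.
Proof. exact: morph0 (mul_midD v). Qed.

Lemma mul_mid0l x : mul_mid 0 x = 0.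
Proof. by apply: (@morph0 _ _ (mul_mid^~ x)) => w w'; exact: mul_midDl. Qed.

Lemma id_bimod_hom : @bimod_hom B B (BAB f) (BAB f) id.
Proof. by []. Qed.

Definition id_endo : bimodHom (BAB f) (BAB f) := BimodHom id_bimod_hom.

Lemma endo_r_id w : endo_r id_endo w = w.
Proof.
elim/tens_indB: w => [x y|x y IHx IHy]; first by rewrite endo_rE.
by rewrite endo_rD IHx IHy.
Qed.

Lemma endo_l_id w : endo_l id_endo w = w.
Proof.
elim/tens_indB: w => [x y|x y IHx IHy]; first by rewrite endo_lE.
by rewrite endo_lD IHx IHy.
Qed.

(** t |-> t^1 g(t^2) and t |-> g(t^1) t^2, the one-sided R-linear functionals
    on T that turn quasibases of A | B into dual bases of T. *)
Definition eps_r (g : bimodHom (BAB f) (BAB f)) (t : TB) : R :=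
  D2_eps (inv_endo_r g t).

Definition eps_l (g : bimodHom (BAB f) (BAB f)) (t : TB) : R :=
  D2_eps (inv_endo_l g t).

Lemma eps_rD g : {morph eps_r g : x y / x + y}.
Proof. by move=> x y; apply: val_inj; rewrite /= endo_rD tens_mulD. Qed.

Lemma eps_lD g : {morph eps_l g : x y / x + y}.
Proof. by move=> x y; apply: val_inj; rewrite /= endo_lD tens_mulD. Qed.

Lemma eps_r_lact g r (t : TB) : eps_r g (r <* t) = r * eps_r g t.
Proof.
apply: val_inj; rewrite -[LHS]/(tens_mul (endo_r g (inv_val (r <* t)))).
by rewrite D2_lactE endo_r_lact tens_mul_lact.
Qed.

Lemma eps_l_ract g (t : TB) r : eps_l g (t *> r) = eps_l g t * r.
Proof.
apply: val_inj; rewrite -[LHS]/(tens_mul (endo_l g (inv_val (t *> r)))).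
by rewrite D2_ractE endo_l_ract tens_mul_ract.
Qed.

Lemma inv_endo_rD g : {morph (inv_endo_r g : TB -> TB) : x y / x + y}.
Proof. by move=> x y; apply: val_inj; exact: endo_rD. Qed.

Lemma inv_endo_lD g : {morph (inv_endo_l g : TB -> TB) : x y / x + y}.
Proof. by move=> x y; apply: val_inj; exact: endo_lD. Qed.

Lemma inv_endo_r_lact g r (t : TB) :
  inv_endo_r g (r <* t) = r <* (inv_endo_r g t : TB).
Proof.
apply: val_inj; rewrite [RHS]D2_lactE.
rewrite -[LHS]/(endo_r g (inv_val (r <* t))) D2_lactE.
exact: endo_r_lact.
Qed.

Lemma inv_endo_l_ract g (t : TB) r :
  inv_endo_l g (t *> r) = (inv_endo_l g t : TB) *> r.
Proof.
apply: val_inj; rewrite [RHS]D2_ractE.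
rewrite -[LHS]/(endo_l g (inv_val (t *> r))) D2_ractE.
exact: endo_l_ract.
Qed.

Lemma eps_bimod_hom : @bimod_hom R R TB (regB R) (@D2_eps k B A f).
Proof.
split=> [t u|r t|t r]; apply: val_inj.
- exact: tens_mulD.
- by rewrite -[LHS]/(tens_mul (inv_val (r <* t))) D2_lactE tens_mul_lact.
- by rewrite -[LHS]/(tens_mul (inv_val (t *> r))) D2_ractE tens_mul_ract.
Qed.

(** The left-hand side is w^1 (t^1 t^2) w^2, which sees t only through its
    counit; both identities expressing the counit of a product follow. *)
Lemma tens_mul_inv_mul (t t' : T) w :
  tens_mul (inv_val t) = tens_mul (inv_val t') ->
  tens_mul (inv_mul t w) = tens_mul (inv_mul t' w).
Proof.
move=> tt'; elim/tens_indB: w => [x y|x y IHx IHy].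
  by rewrite !inv_mulE !tens_mul_ract !tens_mul_lact tt'.
by rewrite !inv_mulD !tens_mulD IHx IHy.
Qed.

Section RightQuasibasis.
Context (I : choiceType) (u : I -> T) (gam : I -> bimodHom (BAB f) (BAB f)).
Hypothesis qb : right_quasibasis u gam.

Lemma right_qb_endo_fin (w : AoA) : finite_set [set i | endo_r (gam i) w <> 0].
Proof.
move: w; apply: (@pointwise_finite_tens I AoA A B A (ABB f) (BBA f)
  (fun i => endo_r (gam i))).
  by move=> i; exact: endo_rD.
move=> x y; apply: sub_finite_set (right_qb_fin qb y) => i /= + gy0; apply.
by rewrite endo_rE gy0 pure0r.
Qed.

(** For w = x \ox y this is the quasibasis identity for 1 \ox y, tensored with x
    on the left. *)
Lemma right_qb_insert1 (w : AoA) : insert1 w =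
  \sum_(i \in [set: I]) mul_mid (inv_val (u i)) (endo_r (gam i) w).
Proof.
pose F i w : AAA := mul_mid (inv_val (u i)) (endo_r (gam i) w).
have FD i : {morph F i : x y / x + y}.
  by move=> x y; rewrite /F endo_rD mul_midD.
have Ffin : pointwise_finite F.
  move=> v; apply: sub_finite_set (right_qb_endo_fin v) => i /= + g0; apply.
  by rewrite /F g0 mul_mid0.
elim/tens_indB: w => [x y|x y Ex Ey]; last first.
  by rewrite (fsumD FD Ffin) insert1D Ex Ey.
rewrite insert1E (right_qbE qb) (fsum_morph (h := @pure A B A (ABB f) BAoA x)).
- by apply: eq_fsbigr => i _; rewrite endo_rE mul_midE mul1r.
- exact: pureDr.
apply: sub_finite_set (right_qb_fin qb y) => i /= + gy0; apply.
by rewrite gy0 mulr0 lact0l.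
Qed.

(** The quasibasis identity represents t^1 \ox 1 \ox t^2 as the sum of the
    t^1 \ox gam_i(t^2) u_i; multiplying the first two factors together gives
    t = \sum_i t^1 gam_i(t^2) u_i, and t^1 gam_i(t^2) lies in R. *)
Lemma right_qb_dual_basis :
  @left_dual_basis R R I TB u (fun i => eps_r (gam i)).
Proof.
have fin (t : TB) : finite_set [set i | eps_r (gam i) t <> 0].
  apply: sub_finite_set (right_qb_endo_fin (inv_val t)) => i /= + g0; apply.
  apply: val_inj => /=; rewrite g0.
  exact: morph0 (@tens_mulD k B A f).
split=> [i|i r t|//|t]; [exact: eps_rD | exact: eps_r_lact | apply: val_inj].
rewrite -[val t in LHS]endo_l_id -mul_endo_l_insert1 right_qb_insert1.
rewrite (fsum_morph (mul_endo_lD _)); last first.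
  apply: sub_finite_set (right_qb_endo_fin (inv_val t)) => i /= + g0; apply.
  by rewrite g0 mul_mid0.
rewrite -[RHS]/((@inv_val k B A f : TB -> AoA) _) (fsum_morph (V := TB)) //;
  last first.
  apply: sub_finite_set (fin t) => i /= + g0; apply.
  by rewrite g0 lact0l.
apply: eq_fsbigr => i _.
by rewrite mul_endo_l_mid endo_l_id D2_lactE.
Qed.

End RightQuasibasis.

Section LeftQuasibasis.
Context (I : choiceType) (ti : I -> T) (bet : I -> bimodHom (BAB f) (BAB f)).
Hypothesis qb : left_quasibasis ti bet.

Lemma left_qb_endo_fin (w : AoA) : finite_set [set i | endo_l (bet i) w <> 0].
Proof.
move: w; apply: (@pointwise_finite_tens I AoA A B A (ABB f) (BBA f)
  (fun i => endo_l (bet i))).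
  by move=> i; exact: endo_lD.
move=> x y; apply: sub_finite_set (left_qb_fin qb x) => i /= + gy0; apply.
by rewrite endo_lE gy0 pure0l.
Qed.

(** For w = x \ox y this is the quasibasis identity for x \ox 1, tensored with y
    on the right. *)
Lemma left_qb_insert1 (w : AoA) : insert1 w =
  \sum_(i \in [set: I]) mul_mid (endo_l (bet i) w) (inv_val (ti i)).
Proof.
pose F i w : AAA := mul_mid (endo_l (bet i) w) (inv_val (ti i)).
have FD i : {morph F i : x y / x + y}.
  by move=> x y; rewrite /F endo_lD mul_midDl.
have Ffin : pointwise_finite F.
  move=> v; apply: sub_finite_set (left_qb_endo_fin v) => i /= + g0; apply.
  by rewrite /F g0 mul_mid0l.
elim/tens_indB: w => [x y|x y Ex Ey]; last first.
  by rewrite (fsumD FD Ffin) insert1D Ex Ey.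
have -> : insert1 (x \oxB y) = mul_mid (1 \oxB y) (x \oxB 1).
  by rewrite insert1E mul_midE oxl mulr1.
rewrite [X in mul_mid _ X](left_qbE qb) (fsum_morph (mul_midD _)).
  apply: eq_fsbigr => i _; rewrite endo_lE mulr1 mul_mid_ract.
  by rewrite oxl mulr1.
apply: sub_finite_set (left_qb_fin qb x) => i /= + gy0; apply.
by rewrite gy0 mul0r ract0r.
Qed.

(** Multiplying the last two factors of t^1 \ox 1 \ox t^2 gives
    t = \sum_i t_i bet_i(t^1) t^2, with bet_i(t^1) t^2 in R. *)
Lemma left_qb_dual_basis :
  @right_dual_basis R R I TB ti (fun i => eps_l (bet i)).
Proof.
have fin (t : TB) : finite_set [set i | eps_l (bet i) t <> 0].
  apply: sub_finite_set (left_qb_endo_fin (inv_val t)) => i /= + g0; apply.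
  apply: val_inj => /=; rewrite g0.
  exact: morph0 (@tens_mulD k B A f).
split=> [i|i t r|//|t]; [exact: eps_lD | exact: eps_l_ract | apply: val_inj].
rewrite -[val t in LHS]endo_r_id -mul_endo_r_insert1 left_qb_insert1.
rewrite (fsum_morph (mul_endo_rD _)); last first.
  apply: sub_finite_set (left_qb_endo_fin (inv_val t)) => i /= + g0; apply.
  by rewrite g0 mul_mid0l.
rewrite -[RHS]/((@inv_val k B A f : TB -> AoA) _) (fsum_morph (V := TB)) //;
  last first.
  apply: sub_finite_set (fin t) => i /= + g0; apply.
  by rewrite g0 ract0r.
apply: eq_fsbigr => i _.
by rewrite mul_endo_r_mid endo_r_id D2_ractE.
Qed.

End LeftQuasibasis.

(** * Injectivity of the embedding *)

Section ContractGlue.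
Context (g : bimodHom (BAB f) (BAB f)).

Lemma contract_r_glue (x : TT) :
  inv_val (contract_r (eps_r g) x) = mul_endo_r g (glue x).
Proof.
have [lD ll] := (eps_rD g, eps_r_lact g).
elim/tens_indR: x => [t u|x y IHx IHy].
  by rewrite contract_rE // D2_ractE glueE mul_endo_r_mid.
by rewrite glueD mul_endo_rD -IHx -IHy contract_rD.
Qed.

Lemma contract_l_glue (x : TT) :
  inv_val (contract_l (eps_l g) x) = mul_endo_l g (glue x).
Proof.
have [lD lr] := (eps_lD g, eps_l_ract g).
elim/tens_indR: x => [t u|x y IHx IHy].
  by rewrite contract_lE // D2_lactE glueE mul_endo_l_mid.
by rewrite glueD mul_endo_lD -IHx -IHy contract_lD.
Qed.

End ContractGlue.

(** The coordinates t u^1 gam_i(u^2) of t \ox u in the dual basis are the images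
    of t^1 \ox t^2 u^1 \ox u^2 under x \ox y \ox z |-> x \ox y gam_i(z), so they
    depend on glue alone. *)
Lemma right_qb_glue_inj (I : choiceType) (u : I -> T)
    (gam : I -> bimodHom (BAB f) (BAB f)) :
  right_quasibasis u gam -> injective glue.
Proof.
move=> qb x y xy; apply: (contract_r_inj (right_qb_dual_basis qb)) => i.
by apply: val_inj; rewrite [LHS]contract_r_glue [RHS]contract_r_glue xy.
Qed.

Lemma left_qb_glue_inj (I : choiceType) (t : I -> T)
    (bet : I -> bimodHom (BAB f) (BAB f)) :
  left_quasibasis t bet -> injective glue.
Proof.
move=> qb x y xy; apply: (contract_l_inj (left_qb_dual_basis qb)) => i.
by apply: val_inj; rewrite [LHS]contract_l_glue [RHS]contract_l_glue xy.
Qed.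

Lemma right_qb_glue_comul (I : choiceType) (u : I -> T)
    (gam : I -> bimodHom (BAB f) (BAB f)) : right_quasibasis u gam ->
  is_coproduct (fun t => \sum_(i \in [set: I]) inv_endo_r (gam i) t \oxR u i).
Proof.
move=> qb t; rewrite (fsum_morph glueD).
  by rewrite (right_qb_insert1 qb); apply: eq_fsbigr => i _; rewrite glueE.
apply: sub_finite_set (right_qb_endo_fin qb (inv_val t)) => i /= + g0; apply.
have -> : inv_endo_r (gam i) t = 0 by apply: val_inj.
exact: pure0l.
Qed.

Lemma left_qb_glue_comul (I : choiceType) (ti : I -> T)
    (bet : I -> bimodHom (BAB f) (BAB f)) : left_quasibasis ti bet ->
  is_coproduct (fun t => \sum_(i \in [set: I]) ti i \oxR inv_endo_l (bet i) t).
Proof.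
move=> qb t; rewrite (fsum_morph glueD).
  by rewrite (left_qb_insert1 qb); apply: eq_fsbigr => i _; rewrite glueE.
apply: sub_finite_set (left_qb_endo_fin qb (inv_val t)) => i /= + g0; apply.
have -> : inv_endo_l (bet i) t = 0 by apply: val_inj.
exact: pure0r.
Qed.

(** Every quasibasis, right or left, yields a preimage of t^1 \ox 1 \ox t^2
    under glue; injectivity makes all these preimages equal. *)
Lemma coproduct_is_D2_comul (Delta : T -> TT) :
  injective glue -> is_coproduct Delta -> is_D2_comul Delta.
Proof.
move=> inj gD; split=> [I u gam qb t|I ti bet qb t]; apply: inj; rewrite gD.
  by rewrite (right_qb_glue_comul qb).
by rewrite (left_qb_glue_comul qb).
Qed.

(** * The bialgebroid laws *)

Definition map_r (h : AoA -> AoA) : AAA -> AAA :=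
  @tens_map A B A A B A (ABB f) BAoA (ABB f) BAoA id h.

Section MapR.
Context (h : AoA -> AoA) (hD : {morph h : x y / x + y}).
Hypothesis hl : forall b w, h (f b <* w) = f b <* h w.

Lemma map_r_bal : @balanced A B A (ABB f) BAoA AAA (fun x w => x \oxC h w).
Proof.
split=> [x x' w|x w w'|x b w]; first by rewrite pureDl.
  by rewrite hD pureDr.
by rewrite oxCA -hl.
Qed.

Lemma map_rE x w : map_r h (x \oxC w) = x \oxC h w.
Proof. exact: tens_liftE map_r_bal. Qed.

Lemma map_rD : {morph map_r h : x y / x + y}.
Proof. exact: tens_liftD map_r_bal. Qed.

Lemma map_r_mid (hA : forall a w, h (a <* w) = a <* h w) w x :
  map_r h (mul_mid w x) = mul_mid (h w) x.
Proof.
elim/tens_indB: x => [x y|x y IHx IHy]; first by rewrite !mul_midE map_rE hA.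
by rewrite !mul_midD map_rD IHx IHy.
Qed.

End MapR.

Section MapL.
Context (g : bimodHom (BAB f) (BAB f)).

Definition map_l : AAA -> AAA :=
  @tens_map A B A A B A (ABB f) BAoA (ABB f) BAoA g id.

Lemma map_l_bal : @balanced A B A (ABB f) BAoA AAA (fun x w => g x \oxC w).
Proof.
split=> [x x' w|x w w'|x b w]; first by rewrite endoD pureDl.
  by rewrite pureDr.
by rewrite [g _]endoMr oxCA.
Qed.

Lemma map_lE x w : map_l (x \oxC w) = g x \oxC w.
Proof. exact: tens_liftE map_l_bal. Qed.

Lemma map_lD : {morph map_l : x y / x + y}.
Proof. exact: tens_liftD map_l_bal. Qed.

Lemma map_l_mid w x : map_l (mul_mid w x) = mul_mid w (endo_l g x).
Proof.
elim/tens_indB: x => [x y|x y IHx IHy]; last first.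
  by rewrite endo_lD !mul_midD map_lD IHx IHy.
by rewrite mul_midE map_lE endo_lE mul_midE.
Qed.

Lemma map_l_insert1 x : map_l (insert1 x) = insert1 (endo_l g x).
Proof.
elim/tens_indB: x => [x y|x y IHx IHy].
  by rewrite endo_lE !insert1E map_lE.
by rewrite endo_lD !insert1D map_lD IHx IHy.
Qed.

Lemma map_r_insert1 x : map_r (endo_r g) (insert1 x) = insert1 (endo_r g x).
Proof.
have hl b w := endo_r_lact g (f b) w.
elim/tens_indB: x => [x y|x y IHx IHy].
  by rewrite endo_rE !insert1E (map_rE (endo_rD g) hl) endo_rE.
by rewrite endo_rD !insert1D (map_rD (endo_rD g) hl) IHx IHy.
Qed.

End MapL.

(** Tool for evaluating Sweedler expressions: if E, followed by an injection j,
    factors through glue, then E is balanced (pull back along j), and its value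
    on x can be read off from glue x. *)
Lemma tens_lift_glue (V W : zmodType) (E : T -> T -> V) (j : V -> W)
    (H : AAA -> W) : {morph j : x y / x + y} -> injective j ->
  {morph H : x y / x + y} ->
  (forall t u : T, j (E t u) = H (mul_mid (inv_val u) (inv_val t))) ->
  forall x : TT, j (@tens_lift R R R TB TB V E x) = H (glue x).
Proof.
move=> jD jI HD jE; have bal : @balanced R R R TB TB V E.
  split=> [t t' u|t u u'|t r u]; apply: jI; rewrite ?jD !jE.
  - by rewrite mul_midD HD.
  - by rewrite mul_midDl HD.
  - by rewrite D2_ractE D2_lactE mul_mid_ract.
elim/tens_indR => [t u|x y IHx IHy].
  by rewrite (tens_liftE _ _ bal) jE glueE.
by rewrite (tens_liftD bal) jD IHx IHy glueD HD.
Qed.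

Section Coproduct.
Context (Delta : T -> TT).
Hypothesis glue_inj : injective glue.
Hypothesis glue_Delta : is_coproduct Delta.

Lemma coproduct_bimod : @bimod_hom R R TB TT Delta.
Proof.
split=> [t u|r t|t r]; apply: glue_inj; rewrite ?glueD ?glue_lact ?glue_ract.
- by rewrite !glue_Delta insert1D.
- by rewrite !glue_Delta D2_lactE insert1_lact.
- by rewrite !glue_Delta D2_ractE insert1_ract.
Qed.

Lemma coproduct1 : Delta 1 = 1 \oxR 1.
Proof.
apply: glue_inj; rewrite glue_Delta glueE /=.
by rewrite mul_midE lact1 insert1E.
Qed.

Lemma coproduct_counitl t :
  @tens_lift R R R TB TB TB (fun t1 t2 : TB => D2_eps t1 <* t2) (Delta t) = t.
Proof.
apply: val_inj; rewrite -[RHS]endo_l_id -mul_endo_l_insert1 -glue_Delta.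
apply: (tens_lift_glue (V := TB) (j := val)) => //; first exact: val_inj.
  exact: mul_endo_lD.
by move=> t1 t2; rewrite mul_endo_l_mid endo_l_id [LHS]D2_lactE.
Qed.

Lemma coproduct_counitr t :
  @tens_lift R R R TB TB TB (fun t1 t2 : TB => t1 *> D2_eps t2) (Delta t) = t.
Proof.
apply: val_inj; rewrite -[RHS]endo_r_id -mul_endo_r_insert1 -glue_Delta.
apply: (tens_lift_glue (V := TB) (j := val)) => //; first exact: val_inj.
  exact: mul_endo_rD.
by move=> t1 t2; rewrite mul_endo_r_mid endo_r_id [LHS]D2_ractE.
Qed.

(** On x \ox 1 \ox y both sides become x \ox r \ox y. *)
Lemma coproduct_takeuchi (r : R) t :
  @tens_lift R R R TB TB TT (fun t1 t2 : T => (D2_src r * t1) \oxR t2)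
    (Delta t) =
  @tens_lift R R R TB TB TT (fun t1 t2 : T => t1 \oxR (D2_tgt r * t2))
    (Delta t).
Proof.
apply: glue_inj.
have lD : {morph (@lact A A AoA (cent_val r)) : x y / x + y}.
  exact: lactDr.
have ll b w : cent_val r <* (f b <* w : AoA) = f b <* (cent_val r <* w).
  by rewrite !lactA centE.
have tD := inv_mulD (D2_tgt r); have tl := inv_mul_lact (D2_tgt r).
rewrite (tens_lift_glue glueD glue_inj (map_rD lD ll)); last first.
  move=> t1 t2; rewrite glueE /=.
  elim/tens_indB: (inv_val t1) => [x y|x y IHx IHy]; last first.
    by rewrite inv_mulD !mul_midD (map_rD lD ll) IHx IHy.
  by rewrite inv_mulE /= oxl oxr !mul_midE (map_rE lD ll) mulr1 lactA.
have tB := map_rD tD (fun b => tl (f b)).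
rewrite (tens_lift_glue glueD glue_inj tB); last first.
  by move=> t1 t2; rewrite glueE (map_r_mid tD).
rewrite glue_Delta.
elim/tens_indB: (inv_val t) => [x y|x y IHx IHy].
  rewrite insert1E (map_rE lD ll) (map_rE tD) // oxl inv_mulE lact1 /=.
  by rewrite oxr mulr1 mul1r.
by rewrite insert1D (map_rD lD ll) (map_rD tD) // IHx IHy.
Qed.

(** For fixed t1 and t2 the inner expression glues to
    u^1 (t1^1 \ox t1^2 t2^1 \ox t2^2) u^2, because the middle factor 1 of
    u^1 \ox 1 \ox u^2 lets t1^2 and t2^1 meet; for the same reason the outer
    expression glues to u^1 t^1 \ox 1 \ox t^2 u^2.  For a general m in
    A \ox_B A \ox_B A the expression u^1 m u^2 depends on how u is written as a
    sum of pure tensors, since b m and m b may differ; fixing one such sum makes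
    it an additive function of m all the same. *)
Lemma coproductM t u : Delta (t * u) =
  @tens_lift R R R TB TB TT (fun t1 t2 : T =>
    @tens_lift R R R TB TB TT (fun u1 u2 : T => (t1 * u1) \oxR (t2 * u2))
      (Delta u)) (Delta t).
Proof.
have [s us] := tens_sum_pure (inv_val u).
pose H (m : AAA) : AAA := \sum_(p <- s) (p.1 : A) <* m *> (p.2 : A).
have HD : {morph H : x y / x + y}.
  by move=> x y; rewrite -big_split; apply: eq_bigr => p _; rewrite lactDr
    ractDl.
apply: glue_inj; rewrite (tens_lift_glue glueD glue_inj HD); last first.
  move=> t1 t2.
  (* x is the first factor of glue (u1 \ox u2), w the other two. *)
  pose K : AAA -> AAA := @tens_lift A B A (ABB f) BAoA AAA (fun x w =>
    (x : A) <* mul_mid (inv_mul t2 w) (inv_val t1)).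
  have Kbal : @balanced A B A (ABB f) BAoA AAA (fun x w =>
    (x : A) <* mul_mid (inv_mul t2 w) (inv_val t1)).
    split=> [x x' w|x w w'|x b w]; first by rewrite lactDl.
      by rewrite inv_mulD mul_midDl lactDr.
    by rewrite -lactA -mul_mid_lact invE mul_mid_ract inv_mul_lact.
  have KD : {morph K : x y / x + y} := tens_liftD Kbal.
  have KE x w : K (x \oxC w) = x <* mul_mid (inv_mul t2 w) (inv_val t1).
    exact: tens_liftE Kbal.
  rewrite (tens_lift_glue glueD glue_inj KD); last first.
    move=> u1 u2; rewrite glueE /=.
    elim/tens_indB: (inv_val u1) => [x y|x y IHx IHy]; last first.
      by rewrite inv_mulD !mul_midD KD -IHx -IHy.
    by rewrite mul_midE KE inv_mulE inv_mul_lact mul_mid_ract mul_mid_lact.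
  rewrite glue_Delta us (morph_sum _ _ insert1D) (morph_sum _ _ KD).
  apply: eq_bigr => p _.
  by rewrite insert1E KE inv_mulE lact1 mul_mid_ractr lractA.
rewrite !glue_Delta /= us (morph_sum _ _ (inv_mulD t)) (morph_sum _ _ insert1D).
by apply: eq_bigr => p _; rewrite inv_mulE insert1_ract insert1_lact.
Qed.

Lemma coproduct_contract_r g t :
  contract_r (eps_r g) (Delta t) = inv_endo_r g t :> TB.
Proof.
by apply: val_inj; rewrite [LHS]contract_r_glue glue_Delta mul_endo_r_insert1.
Qed.

Lemma coproduct_contract_l g t :
  contract_l (eps_l g) (Delta t) = inv_endo_l g t :> TB.
Proof.
by apply: val_inj; rewrite [LHS]contract_l_glue glue_Delta mul_endo_l_insert1.
Qed.

(** Both sides represent t^1 \ox 1 \ox g(t^2). *)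
Lemma coproduct_endo_r g t :
  @tens_map R R R R R R TB TB TB TB id (inv_endo_r g) (Delta t) =
  Delta (inv_endo_r g t).
Proof.
have [iD il] := (@inv_endo_rD g, @inv_endo_r_lact g).
have gD := endo_rD g; have gl := endo_r_lact g.
apply: glue_inj; rewrite glue_Delta -[RHS]map_r_insert1 -glue_Delta.
elim/tens_indR: (Delta t) => [t1 t2|x y IHx IHy].
  by rewrite (tens_maprE iD il) !glueE (map_r_mid gD (fun b => gl (f b))).
by rewrite (tens_maprD iD il) !glueD (map_rD gD (fun b => gl (f b))) IHx IHy.
Qed.

(** Both sides represent g(t^1) \ox 1 \ox t^2. *)
Lemma coproduct_endo_l g t :
  @tens_map R R R R R R TB TB TB TB (inv_endo_l g) id (Delta t) =
  Delta (inv_endo_l g t).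
Proof.
have [iD ir] := (@inv_endo_lD g, @inv_endo_l_ract g).
apply: glue_inj; rewrite glue_Delta -[RHS]map_l_insert1 -glue_Delta.
elim/tens_indR: (Delta t) => [t1 t2|x y IHx IHy].
  by rewrite (tens_maplE iD ir) !glueE map_l_mid.
by rewrite (tens_maplD iD ir) !glueD map_lD IHx IHy.
Qed.

Let Delta_hom := coproduct_bimod.
Let DeltaD : {morph (Delta : TB -> TT) : x y / x + y}.
Proof. by case: Delta_hom. Qed.
Let Delta_l r (t : TB) : Delta (r <* t) = r <* Delta t.
Proof. by case: Delta_hom. Qed.
Let Delta_r (t : TB) r : Delta (t *> r) = Delta t *> r.
Proof. by case: Delta_hom. Qed.

(** Elements of T \ox_R (T \ox_R T) are separated by contracting the last factor
    with the functionals of the dual basis.  These contractions turn the two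
    sides into Delta (t^1 \ox gam_i(t^2)) and t_(1) \ox gam_i(t_(2)), which
    agree by coproduct_endo_r. *)
Lemma right_qb_coassoc (I : choiceType) (u : I -> T)
    (gam : I -> bimodHom (BAB f) (BAB f)) : right_quasibasis u gam -> forall t,
  tens_assoc (@tens_map R R R R R R TB TB TT TB Delta id (Delta t)) =
  @tens_map R R R R R R TB TB TB TT id Delta (Delta t).
Proof.
(* Contracting the last factor is available on (T \ox T) \ox T, hence the
   passage to a preimage under the associator. *)
move=> qb t; have [x xE] := tens_assoc_surj
  (@tens_map R R R R R R TB TB TB TT id Delta (Delta t)).
rewrite -xE; congr tens_assoc.
apply: (contract_r_inj (right_qb_dual_basis qb)) => i.
have [lD ll] := (eps_rD (gam i), eps_r_lact (gam i)).
rewrite (contract_r_map lD ll DeltaD Delta_r) coproduct_contract_r.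
rewrite -coproduct_endo_r -(contract_r_assoc lD ll) xE.
have cD : {morph (contract_r (eps_r (gam i)) : TT -> TB) : x y / x + y}.
  exact: contract_rD.
have cl r (y : TT) : contract_r (eps_r (gam i)) (r <* y) =
    r <* (contract_r (eps_r (gam i)) y : TB) by exact: contract_r_lact.
elim/tens_indR: (Delta t) => [t1 t2|y z IHy IHz]; last first.
  rewrite (tens_maprD (inv_endo_rD (gam i)) (@inv_endo_r_lact (gam i))) IHy IHz.
  by rewrite (tens_maprD DeltaD Delta_l) (tens_maprD cD cl).
rewrite (tens_maprE (inv_endo_rD (gam i)) (@inv_endo_r_lact (gam i))).
by rewrite (tens_maprE DeltaD Delta_l) (tens_maprE cD cl) coproduct_contract_r.
Qed.

(** The mirror image: contracting the first factor gives
    Delta (bet_i(t^1) \ox t^2) and bet_i(t_(1)) \ox t_(2). *)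
Lemma left_qb_coassoc (I : choiceType) (ti : I -> T)
    (bet : I -> bimodHom (BAB f) (BAB f)) : left_quasibasis ti bet -> forall t,
  tens_assoc (@tens_map R R R R R R TB TB TT TB Delta id (Delta t)) =
  @tens_map R R R R R R TB TB TB TT id Delta (Delta t).
Proof.
move=> qb t; apply: (contract_l_inj (left_qb_dual_basis qb)) => i.
have [lD lr] := (eps_lD (bet i), eps_l_ract (bet i)).
rewrite (contract_l_map lD lr DeltaD Delta_l) coproduct_contract_l.
rewrite -coproduct_endo_l (contract_l_assoc lD lr).
have cD : {morph (contract_l (eps_l (bet i)) : TT -> TB) : x y / x + y}.
  exact: contract_lD.
have cr (y : TT) r : contract_l (eps_l (bet i)) (y *> r) =
    (contract_l (eps_l (bet i)) y : TB) *> r by exact: contract_l_ract.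
elim/tens_indR: (Delta t) => [t1 t2|y z IHy IHz]; last first.
  rewrite (tens_maplD (inv_endo_lD (bet i)) (@inv_endo_l_ract (bet i))).
  rewrite -IHy -IHz.
  by rewrite (tens_maplD DeltaD Delta_r) (tens_maplD cD cr).
rewrite (tens_maplE (inv_endo_lD (bet i)) (@inv_endo_l_ract (bet i))).
by rewrite (tens_maplE DeltaD Delta_r) (tens_maplE cD cr) coproduct_contract_l.
Qed.

Lemma coproduct_bialgebroid :
  (forall t, tens_assoc (@tens_map R R R R R R TB TB TT TB Delta id (Delta t)) =
    @tens_map R R R R R R TB TB TB TT id Delta (Delta t)) ->
  is_right_bialgebroid (S := D2_base f) Delta (@D2_eps k B A f).
Proof.
move=> coassoc; split=> //.
- exact: eps_bimod_hom.
- exact: coproduct_counitl.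
- exact: coproduct_counitr.
- exact: coproduct1.
- by apply: val_inj; rewrite /= tens_mulE mulr1.
- exact: coproduct_takeuchi.
- exact: coproductM.
- move=> t u; apply: val_inj; apply: tens_mul_inv_mul.
  by rewrite /= tens_mulE mul1r.
- move=> t u; apply: val_inj; apply: tens_mul_inv_mul.
  by rewrite /= tens_mulE mulr1.
Qed.

End Coproduct.
End DepthTwo.

Theorem theorem2p2 (k : comPzRingType) (B A : pzAlgType k) (f : algHom B A) :
  right_D2 f \/ left_D2 f ->
  exists Delta : tens_inv f -> tens (baseB (D2_base f)) (baseB (D2_base f)),
    is_D2_comul Delta /\
    is_right_bialgebroid (S := D2_base f) Delta (@D2_eps k B A f).
Proof.
case=> [/right_D2_quasibasis|/left_D2_quasibasis] [I [u [gam qb]]].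
  have inj := right_qb_glue_inj qb; have gD := right_qb_glue_comul qb.
  eexists; split; first exact: coproduct_is_D2_comul inj gD.
  exact: (coproduct_bialgebroid inj gD (right_qb_coassoc inj gD qb)).
have inj := left_qb_glue_inj qb; have gD := left_qb_glue_comul qb.
eexists; split; first exact: coproduct_is_D2_comul inj gD.
exact: (coproduct_bialgebroid inj gD (left_qb_coassoc inj gD qb)).
Qed.
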